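(* Let $T$ be a complete first order theory. (1) If $\vartheta(\bar x,\bar y)$ exemplifies $SOP_2$ in $T$, then $\vartheta(\bar x;\bar y)$ exemplifies $SOP''_2$ in $T$ as well. (2) If $\vartheta(\bar x,\bar y)$ exemplifies $SOP''_2$ in $T$, then for some $k$, $\vartheta^{<k>}(\bar x;\bar y^{<k>})$ exemplifies $SOP_2$ in $T$, where $\vartheta^{<k>}(\bar x;\bar y^{<k>})=\bigwedge_{\ell<k}\vartheta(\bar x;\bar y_\ell)$ and $\bar y^{<k>}=\bar y_0\frown\cdots\frown\bar y_{k-1}$.
   Context: $\mathfrak C$ is the monster model of $T$. ${}^{\lambda}2$ and ${}^{\lambda>}2$ are the sets of $0$-$1$ sequences of length $\lambda$ and of length $<\lambda$; ${}^nm$ and ${}^{n\ge}m$ are the sets of sequences of elements of $m=\{0,\dots,m-1\}$ of length $n$ and of length at most $n$. $\eta\vartriangleleft\nu$ means $\eta$ is a proper initial segment of $\nu$; $\eta\perp\nu$ means $\eta,\nu$ are incomparable (neither is an initial segment of the other); $\eta\restriction\alpha$ is the initial segment of length $\alpha$; $\lg(\eta)$ is the length of $\eta$. $\varphi(\bar x,\bar y)$ exemplifies $SOP_2$ in $T$ if there are $\bar a_\eta\in\mathfrak C$ for $\eta\in{}^{\omega>}2$ such that (a) for every $\eta\in{}^\omega2$ the set $\{\varphi(\bar x,\bar a_{\eta\restriction l}):l<\omega\}$ is consistent; (b) if $\eta,\nu\in{}^{\omega>}2$ are incomparable, then $\{\varphi(\bar x,\bar a_\eta),\varphi(\bar x,\bar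 a_\nu)\}$ is inconsistent. $\varphi(\bar x,\bar y)$ exemplifies $SOP''_2$ in $T$ if for some $n<\omega$ and some infinite cardinal $\lambda$ there is a sequence $\langle\bar a_{\bar\eta}\rangle$ in $\mathfrak C$, indexed by all $\bar\eta=\langle\eta_0,\dots,\eta_n\rangle$ with $\eta_0\vartriangleleft\eta_1\vartriangleleft\dots\vartriangleleft\eta_n\in{}^{\lambda>}2$ and each $\lg(\eta_i)$ a successor ordinal, such that: (a) for each $\eta\in{}^\lambda2$ the set $\{\varphi(\bar x,\bar a_{\bar\eta}):\bar\eta=\langle\eta\restriction(\alpha_0+1),\dots,\eta\restriction(\alpha_n+1)\rangle,\ \alpha_0<\dots<\alpha_n<\lambda\}$ is consistent; (b) for every large enough $m$, if $h$ is a one-to-one function from ${}^{n\ge}m$ into the elements of ${}^{\lambda>}2$ of successor length which preserves $\eta\vartriangleleft\nu$ and $\eta\perp\nu$, then $\{\varphi(\bar x,\bar a_{\bar\nu}):\text{for some }\eta\in{}^nm,\ \bar\nu=\langle h(\eta\restriction\ell):\ell\le n\rangle\}$ is inconsistent. *)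

(* Defs.v *)
From mathcomp Require Import all_boot all_order.
From mathcomp Require Import boolp classical_sets functions cardinality wochoice.

Set Implicit Arguments.
Unset Strict Implicit.
Unset Printing Implicit Defensive.

Local Open Scope classical_set_scope.
Local Open Scope card_scope.

Definition copair (A B C : Type) (f : A -> C) (g : B -> C) (v : A + B) : C :=
  match v with inl a => f a | inr b => g b end.

Record language := Language {
  fsym : Type;
  farity : fsym -> nat;
  rsym : Type;
  rarity : rsym -> nat }.

Inductive term (L : language) (V : Type) : Type :=
  | tVar (v : V)
  | tApp (f : fsym L) (ts : 'I_(farity f) -> term L V).

(* [formula L V] is the type of formulas whose free variables are in [V]; in
   [fEx phi] the variable [None] is the bound one. *)
Inductive formula (L : language) (V : Type) : Type :=
  | fTrue
  | fEq (t u : term L V)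
  | fRel (r : rsym L) (ts : 'I_(rarity r) -> term L V)
  | fNot (phi : formula L V)
  | fAnd (phi psi : formula L V)
  | fEx (phi : formula L (option V)).

Arguments fTrue {L V}.

Fixpoint trename (L : language) (V W : Type) (f : V -> W) (t : term L V) :
    term L W :=
  match t with
  | tVar v => tVar L (f v)
  | tApp g ts => tApp (fun i => trename f (ts i))
  end.

Fixpoint rename (L : language) (V W : Type) (f : V -> W) (phi : formula L V) :
    formula L W :=
  match phi with
  | fTrue => fTrue
  | fEq t u => fEq (trename f t) (trename f u)
  | fRel r ts => fRel (fun i => trename f (ts i))
  | fNot phi => fNot (rename f phi)
  | fAnd phi psi => fAnd (rename f phi) (rename f psi)
  | fEx phi => fEx (rename (omap f) phi)
  end.

Record structure (L : language) := Structure {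
  carrier :> Type;
  carrier_inhabited : inhabited carrier;
  fint : forall f : fsym L, ('I_(farity f) -> carrier) -> carrier;
  rint : forall r : rsym L, ('I_(rarity r) -> carrier) -> Prop }.

Fixpoint eval (L : language) (M : structure L) (V : Type) (e : V -> M)
    (t : term L V) : M :=
  match t with
  | tVar v => e v
  | tApp f ts => fint (fun i => eval e (ts i))
  end.

Fixpoint sat (L : language) (M : structure L) (V : Type) (e : V -> M)
    (phi : formula L V) : Prop :=
  match phi with
  | fTrue => True
  | fEq t u => eval e t = eval e u
  | fRel r ts => rint (fun i => eval e (ts i))
  | fNot phi => ~ sat e phi
  | fAnd phi psi => sat e phi /\ sat e psi
  | fEx phi => exists x : M, sat (oapp e x) phi
  end.

Definition sentence (L : language) := formula L void.

Definition models (L : language) (M : structure L) (T : set (sentence L)) :=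
  forall sigma, T sigma -> sat (of_void M) sigma.

Definition entails (L : language) (T : set (sentence L)) (sigma : sentence L) :=
  forall M : structure L, models M T -> sat (of_void M) sigma.

Definition complete_theory (L : language) (T : set (sentence L)) :=
  (exists M : structure L, models M T) /\
  forall sigma, entails T sigma \/ entails T (fNot sigma).

(* A formula in the variables [X] with parameters from a structure [M] is a
   formula over [X + M], a variable [inr c] being interpreted as [c] itself. *)
Definition satisfies (L : language) (M : structure L) (X : Type) (d : X -> M)
    (psi : formula L (X + M)) : Prop :=
  sat (copair d id) psi.

Definition realizes (L : language) (M : structure L) (X : Type) (d : X -> M)
    (P : set (formula L (X + M))) : Prop :=
  forall psi, P psi -> satisfies d psi.

(* Finite satisfiability in [M], i.e. consistency with the elementary diagram of
   [M]; by saturation, a small consistent set is realized in a monster model. *)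
Definition consistent (L : language) (M : structure L) (X : Type)
    (P : set (formula L (X + M))) : Prop :=
  forall F, F `<=` P -> finite_set F -> exists d : X -> M, realizes d F.

(* |A| < |B|, by comparability of cardinals *)
Definition card_lt (T U : Type) (A : set T) (B : set U) : Prop :=
  ~ (B #<= A).

(* In [saturated], [strongly_homogeneous] and [monster] the type [K] stands for
   the cardinal |K|. *)
Definition saturated (L : language) (K : Type) (M : structure L) :=
  forall (A : set M) (p : nat) (P : set (formula L ('I_p + A))),
    card_lt A [set: K] ->
    let PM := [set rename (copair inl (fun c : A => inr (set_val c))) psi
              | psi in P] in
    consistent PM -> exists d : 'I_p -> M, realizes d PM.

Definition automorphism (L : language) (M : structure L) (g : M -> M) :=
  [/\ bijective g,
      forall (f : fsym L) (x : 'I_(farity f) -> M),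
        g (fint x) = fint (fun i => g (x i)) &
      forall (r : rsym L) (x : 'I_(rarity r) -> M),
        rint (fun i => g (x i)) <-> rint x].

Definition strongly_homogeneous (L : language) (K : Type) (M : structure L) :=
  forall (A : set M) (f : A -> M),
    card_lt A [set: K] ->
    (forall phi : formula L A, sat f phi <-> sat (@set_val _ A) phi) ->
    exists2 g : M -> M, automorphism g & forall c : A, g (set_val c) = f c.

(* [formula L nat] has cardinality |L| + aleph_0. *)
Record monster (L : language) (T : set (sentence L)) (K : Type)
    (C : structure L) : Prop := Monster {
  monster_models : models C T;
  monster_large : card_lt [set: formula L nat] [set: K];
  monster_saturated : saturated K C;
  monster_homogeneous : strongly_homogeneous K C }.

(* phi(xbar, ybar), with xbar of length [p] and ybar of length [q]. *)
Definition pformula (L : language) (p q : nat) := formula L ('I_p + 'I_q).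

Definition instance (L : language) (M : structure L) (p q : nat)
    (phi : pformula L p q) (b : 'I_q -> M) : formula L ('I_p + M) :=
  rename (copair inl (fun j => inr (b j))) phi.

Lemma cat_index_subproof (k q : nat) (l : 'I_k) (j : 'I_q) : l * q + j < k * q.
Proof.
apply: (@leq_trans (l.+1 * q)); last by rewrite leq_mul2r ltn_ord orbT.
by rewrite mulSn addnC ltn_add2r.
Qed.

(* The position of the [j]-th entry of the [l]-th block in a concatenation of
   [k] tuples of length [q]. *)
Definition cat_index (k q : nat) (l : 'I_k) (j : 'I_q) : 'I_(k * q) :=
  Ordinal (cat_index_subproof l j).

Definition conj_power (L : language) (p q : nat) (phi : pformula L p q)
    (k : nat) : pformula L p (k * q) :=
  \big[@fAnd L _/fTrue]_(l < k)
    rename (copair inl (fun j => inr (cat_index l j))) phi.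

Definition proper_prefix (A : eqType) (s t : seq A) : bool :=
  prefix s t && (s != t).

Definition incomparable (A : eqType) (s t : seq A) : bool :=
  ~~ prefix s t && ~~ prefix t s.

Section Dyadic.
Local Open Scope order_scope.

(* A cardinal is an initial ordinal: a well-order not equinumerous with any of
   its proper initial segments.  An element of it is identified with the ordinal
   of its predecessors, so that the elements of [W] are the ordinals below it. *)
Definition infinite_cardinal (d : Order.disp_t) (W : orderType d) : Prop :=
  [/\ well_order (<=%O : rel W),
      infinite_set [set: W] &
      forall a : W, card_lt [set v : W | v < a] [set: W]].

Variables (d : Order.disp_t) (W : orderType d).

(* [b] is the ordinal [a + 1] *)
Definition succ_of (a b : W) : Prop := a < b /\ forall v, ~~ (a < v < b).

Definition is_successor (b : W) : Prop := exists a, succ_of a b.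

Record dseq := DSeq { lg : W; dval :> {v : W | v < lg} -> bool }.

Definition initial (s t : dseq) : Prop :=
  lg s <= lg t /\
  forall v (hs : v < lg s) (ht : v < lg t), s (exist _ v hs) = t (exist _ v ht).

Definition proper_initial (s t : dseq) : Prop := initial s t /\ lg s < lg t.

Definition dincomparable (s t : dseq) : Prop := ~ initial s t /\ ~ initial t s.

Definition restr (eta : W -> bool) (a : W) : dseq :=
  @DSeq a (fun v => eta (sval v)).

Record dchain (n : nat) := DChain {
  entry :> 'I_n.+1 -> dseq;
  entry_succ : forall i, is_successor (lg (entry i));
  entry_lt : forall i j : 'I_n.+1, (i < j)%N ->
    proper_initial (entry i) (entry j) }.

Definition branch_chain (n : nat) (eta : W -> bool) (c : dchain n) : Prop :=
  exists alpha : 'I_n.+1 -> W,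
    (forall i j : 'I_n.+1, (i < j)%N -> alpha i < alpha j) /\
    forall i, exists2 b, succ_of (alpha i) b & c i = restr eta b.

Definition tree_embedding (n m : nat) (h : n.-bseq 'I_m -> dseq) : Prop :=
  [/\ injective h,
      forall s, is_successor (lg (h s)),
      forall s t : n.-bseq 'I_m, proper_prefix s t -> proper_initial (h s) (h t) &
      forall s t : n.-bseq 'I_m, incomparable s t -> dincomparable (h s) (h t)].

Definition image_chain (n m : nat) (h : n.-bseq 'I_m -> dseq)
    (eta : n.-tuple 'I_m) (c : dchain n) : Prop :=
  forall (l : 'I_n.+1) (s : n.-bseq 'I_m), s = take l eta :> seq 'I_m -> c l = h s.

End Dyadic.

Definition exemplifies_SOP2 (L : language) (C : structure L) (p q : nat)
    (phi : pformula L p q) : Prop :=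
  exists a : seq bool -> 'I_q -> C,
    (forall eta : nat -> bool,
       consistent [set instance phi (a (mkseq eta l)) | l in [set: nat]]) /\
    (forall eta nu : seq bool, incomparable eta nu ->
       ~ consistent [set instance phi (a eta); instance phi (a nu)]).

Definition exemplifies_SOP2'' (L : language) (C : structure L) (p q : nat)
    (phi : pformula L p q) : Prop :=
  exists (n : nat) (d : Order.disp_t) (W : orderType d),
    infinite_cardinal W /\
  exists a : dchain W n -> 'I_q -> C,
    (forall eta : W -> bool,
       consistent [set instance phi (a c) | c in branch_chain (n := n) eta]) /\
    (exists m0 : nat, forall m, m0 <= m ->
     forall h : n.-bseq 'I_m -> dseq W, tree_embedding h ->
       ~ consistent [set instance phi (a c)
                    | c in [set c : dchain W n | exists eta : n.-tuple 'I_m,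
                              image_chain h eta c]]).

(* Main.v *)
Require Import Defs.
From mathcomp Require Import all_boot all_order.
From mathcomp Require Import boolp classical_sets functions cardinality wochoice.
From mathcomp Require Import zify.

(** Part (1) uses chains of two nodes in the tree of finite sequences, with
    [a_(eta_0, eta_1) = a_(eta_1)]: two incomparable nodes are already inconsistent.

    For part (2), identify a finite set of nodes of [2^<omega] with the set of
    [(n+1)-chains] it contains; chains of nodes are then consistent, and copies of
    the [m]-ary tree of height [n] are not.  More generally consider systems
    attaching to every node a finite set, of bounded size, consistent along chains.
    Say that a finite set [A], consistent with the branches of such a system, can be
    extended if a tooth [s] can be added to [A] and a subtree, incomparable with [s],
    found whose branches are consistent with [A] and [s].
    - If this is always possible, adding [m] teeth to every node gives a new system,
      which excludes the [m]-ary tree of height [n - 1]; induction on [n] applies.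
    - Otherwise some [A] is stuck: above any node incomparable with [s] there are
      chains of fixed length [M] contradicting [A] and [s].  By a Ramsey theorem for
      chains in trees all [M]-chains of a subtree do so, hence one can build a tree
      of [M]-chains in which incomparable chains contradict each other over [A].
      Each tuple formed by [A] and an [M]-chain has bounded size.
    This yields trees of every finite height for one conjunction [theta^<k>], and
    saturation of the monster model yields an infinite one. *)

Set Implicit Arguments.
Unset Strict Implicit.
Unset Printing Implicit Defensive.

Import Order.TTheory.

Local Open Scope classical_set_scope.
Local Open Scope card_scope.

(** * Prefixes and chains in the binary tree *)

Section Prefixes.
Variable T : eqType.
Implicit Types s t u : seq T.

Lemma proper_prefix_cons x y s t :
  proper_prefix (x :: s) (y :: t) = (x == y) && proper_prefix s t.
Proof. by rewrite /proper_prefix prefix_cons eqseq_cons; case: eqP. Qed.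

Lemma proper_prefixs0 s : proper_prefix s [::] = false.
Proof. by rewrite /proper_prefix prefixs0 andbN. Qed.

Lemma proper_prefix0s s : proper_prefix [::] s = (s != [::]).
Proof. by rewrite /proper_prefix prefix0s eq_sym. Qed.

Lemma incomparable_cons x y s t :
  incomparable (x :: s) (y :: t) = (x != y) || incomparable s t.
Proof.
by rewrite /incomparable !prefix_cons (eq_sym y); case: eqP.
Qed.

Lemma incomparable0s s : incomparable [::] s = false.
Proof. by rewrite /incomparable prefix0s. Qed.

Lemma incomparables0 s : incomparable s [::] = false.
Proof. by rewrite /incomparable prefix0s andbF. Qed.

Lemma incomparable_sym s t : incomparable s t = incomparable t s.
Proof. exact: andbC. Qed.

Lemma proper_prefixW s t : proper_prefix s t -> prefix s t.
Proof. by case/andP. Qed.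

Lemma prefix_eqVproper s t : prefix s t = (s == t) || proper_prefix s t.
Proof. by rewrite /proper_prefix; case: eqP => [->|]; rewrite ?prefix_refl ?andbT. Qed.

Lemma proper_prefix_size s t : proper_prefix s t -> size s < size t.
Proof.
elim: s t => [|x s IH] [|y t] //; rewrite ?proper_prefixs0 ?proper_prefix_cons //.
by case/andP => _ /IH.
Qed.

Lemma proper_prefix_trans : transitive (@proper_prefix T).
Proof.
move=> t s u st tu; apply/andP; split.
  exact: prefix_trans (proper_prefixW st) (proper_prefixW tu).
apply: contraTneq (ltn_trans (proper_prefix_size st) (proper_prefix_size tu)) => ->.
by rewrite ltnn.
Qed.

Lemma proper_prefix_prefix_trans s t u :
  proper_prefix s t -> prefix t u -> proper_prefix s u.
Proof.
by move=> st; rewrite prefix_eqVproper => /orP[/eqP<- //|]; exact: proper_prefix_trans.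
Qed.

Lemma prefix_proper_prefix_trans s t u :
  prefix s t -> proper_prefix t u -> proper_prefix s u.
Proof.
by rewrite prefix_eqVproper => /orP[/eqP<- //|st tu]; exact: proper_prefix_trans tu.
Qed.

Lemma proper_prefix_cat u s t : proper_prefix (u ++ s) (u ++ t) = proper_prefix s t.
Proof. by elim: u => //= x u IH; rewrite proper_prefix_cons eqxx. Qed.

Lemma incomparable_cat u s t : incomparable (u ++ s) (u ++ t) = incomparable s t.
Proof. by elim: u => //= x u IH; rewrite incomparable_cons eqxx. Qed.

Lemma prefix_comparable s t u : prefix s u -> prefix t u -> ~~ incomparable s t.
Proof.
elim: s t u => [|x s IH] [|y t] [|z u] //;
  rewrite ?incomparable0s ?incomparables0 // !prefix_cons incomparable_cons.
by move=> /andP[/eqP-> su] /andP[/eqP-> tu]; rewrite eqxx (IH _ u).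
Qed.

Lemma incomparable_mono s t s' t' :
  incomparable s t -> prefix s s' -> prefix t t' -> incomparable s' t'.
Proof.
move=> st ss' tt'; apply/andP; split; apply/negP => H; move: st; apply/negP.
  exact: (prefix_comparable (u := t')) (prefix_trans ss' H) tt'.
exact: (prefix_comparable (u := s')) ss' (prefix_trans tt' H).
Qed.

Lemma chain_prefix_last x c : path (@proper_prefix T) x c ->
  {in x :: c, forall s, prefix s (last x c)}.
Proof.
elim: c x => [|y c IH] x /=; first by move=> _ s; rewrite inE => /eqP->; exact: prefix_refl.
case/andP => xy yc s; rewrite inE => /orP[/eqP->|]; last exact: IH.
by apply: prefix_trans (proper_prefixW xy) _; apply: IH yc _ (mem_head _ _).
Qed.

Lemma take_minn i s : take (minn i (size s)) s = take i s.
Proof. by case: leqP => // /ltnW/take_oversize ->; rewrite take_size. Qed.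

Lemma sorted_prefixes w M : M <= (size w).+1 ->
  sorted (@proper_prefix T) [seq take i w | i <- iota 0 M].
Proof.
move=> Mw; apply: (@homo_sorted_in _ _ (fun i => i < M) _ ltn).
- move=> i j iM jM /= ij; rewrite /proper_prefix.
  have -> : take i w = take i (take j w) by rewrite take_takel // ltnW.
  rewrite prefix_take /=; apply: contraTneq ij => /(congr1 size).
  have jw : j <= size w by rewrite -ltnS (leq_trans jM).
  rewrite size_take_min (size_takel jw) => /minn_idPr.
  by rewrite leqNgt.
- by apply/allP => i; rewrite mem_iota add0n.
- exact: iota_ltn_sorted.
Qed.

End Prefixes.

Notation node := (seq bool).
Notation chain := (sorted (@proper_prefix bool)).

(** All nodes of a chain are prefixes of one node, which can be lengthened to some [w] with at least
    [M] bits; the prefixes of [w] shorter than [M] form the required chain. *)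
Lemma chain_extend (c : seq node) M : chain c -> all (fun s => size s < M) c ->
  exists c' : seq node, [/\ chain c', size c' = M,
    all (fun s => size s < M) c' & {subset c <= c'}].
Proof.
move=> cc cM.
have [w [Mw cw]] : exists w : node, M <= size w /\
    {in c, forall s, prefix s w}.
  case: c cc cM => [_ _|x c /chain_prefix_last xc _].
    by exists (nseq M true); rewrite size_nseq.
  exists (last x c ++ nseq M true); rewrite size_cat size_nseq leq_addl; split=> // s sc.
  exact: prefix_catl (xc _ sc).
exists [seq take i w | i <- iota 0 M]; split.
- exact/sorted_prefixes/leqW.
- by rewrite size_map size_iota.
- apply/allP => _ /mapP[i + ->]; rewrite mem_iota add0n => /andP[_ iM].
  by rewrite (leq_ltn_trans _ iM) // size_take_min geq_minl.
- move=> s sc; apply/mapP; exists (size s).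
    by rewrite mem_iota add0n (allP cM).
  by have := cw _ sc; rewrite prefixE => /eqP.
Qed.

(** * Embeddings of the binary tree into itself *)

Definition embedding (e : node -> node) : Prop :=
  (forall s t, proper_prefix s t -> proper_prefix (e s) (e t)) /\
  (forall s t, incomparable s t -> incomparable (e s) (e t)).

Lemma embedding_id : embedding id.
Proof. by []. Qed.

Lemma embedding_comp e f : embedding e -> embedding f -> embedding (e \o f).
Proof. by move=> [e1 e2] [f1 f2]; split=> s t st; [apply/e1/f1 | apply/e2/f2]. Qed.

Lemma embedding_cat u : embedding (cat u).
Proof. by split=> s t; rewrite ?proper_prefix_cat ?incomparable_cat. Qed.

Definition join_trees (E : bool -> node -> node) (s : node) : node :=
  if s is b :: s' then E b s' else [::].

Lemma embedding_join E : (forall b, embedding (E b)) ->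
  (forall b s, E b s != [::]) ->
  (forall s t, incomparable (E false s) (E true t)) -> embedding (join_trees E).
Proof.
move=> Eemb E0 Ei; split=> -[|b s] [|b' t];
  rewrite ?proper_prefixs0 ?incomparable0s ?incomparables0 //.
- by rewrite !proper_prefix0s E0.
- by rewrite proper_prefix_cons => /andP[/eqP-> st]; apply: (Eemb b').1.
- rewrite incomparable_cons; have [->|bb' _] /= := eqVneq b b'.
    by move=> st; apply: (Eemb b').2.
  by case: b b' bb' => -[] // _; rewrite 1?incomparable_sym.
Qed.

Lemma embedding_join_cons E : (forall b, embedding (E b)) ->
  embedding (join_trees (fun b s => b :: E b s)).
Proof.
move=> Eemb; apply: embedding_join => [b|//|s t]; last by rewrite incomparable_cons.
by have [E1 E2] := Eemb b; split=> s t st /=;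
  rewrite ?proper_prefix_cons ?incomparable_cons eqxx ?E1 ?E2.
Qed.

Lemma embedding_prefix e s t : embedding e -> prefix s t -> prefix (e s) (e t).
Proof.
move=> [e1 _]; rewrite prefix_eqVproper => /orP[/eqP->|/e1/proper_prefixW //].
exact: prefix_refl.
Qed.

Lemma embedding_chain e (c : seq node) : embedding e -> chain c -> chain (map e c).
Proof. by move=> [e1 _]; apply: homo_sorted. Qed.

(** * Ramsey theorem for chains *)

Definition bounded (H N : nat) (e : node -> node) : Prop :=
  forall s, size s < H -> size (e s) < N.

(** Induction on [p + q]: the color of the root decides which height decreases. If one of the two
    subtrees contains the full tree of the other color, that tree is taken; otherwise the trees
    found in both are joined above the root. *)
Lemma node_ramsey (p q : nat) (v : node -> bool) : exists2 e, embedding e &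
  (bounded p (p + q) e /\ forall s, size s < p -> v (e s)) \/
  (bounded q (p + q) e /\ forall s, size s < q -> v (e s) = false).
Proof.
have [n] := ubnP (p + q); elim: n => // n IH in p q v *; rewrite ltnS => pqn.
case: p pqn => [|p] pqn; first by exists id => //; left.
case: q pqn => [|q] pqn; first by exists id => //; right.
case v0: (v [::]).
- have IHb b := IH p q.+1 (fun s => v (b :: s)) pqn.
  have [e0 E0 [P0|[B0 V0]]] := IHb false; last first.
    exists (cat [:: false] \o e0); first exact: embedding_comp (embedding_cat _) E0.
    by right; split=> s /[dup] /B0 ? /V0 ?.
  have [e1 E1 [P1|[B1 V1]]] := IHb true; last first.
    exists (cat [:: true] \o e1); first exact: embedding_comp (embedding_cat _) E1.
    by right; split=> s /[dup] /B1 ? /V1 ?.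
  exists (join_trees (fun b s => b :: (if b then e1 else e0) s)).
    by apply: embedding_join_cons => -[].
  by left; split=> -[|[] s] //=; rewrite ltnS;
    first [exact: P1.1 | exact: P0.1 | exact: P1.2 | exact: P0.2].
- have pqn' : p.+1 + q < n by rewrite addSnnS.
  have IHb b := IH p.+1 q (fun s => v (b :: s)) pqn'.
  rewrite -addSnnS in IHb *.
  have [e0 E0 [[B0 V0]|P0]] := IHb false.
    exists (cat [:: false] \o e0); first exact: embedding_comp (embedding_cat _) E0.
    by left; split=> s; rewrite -?addSnnS => /[dup] /B0 ? /V0 ?.
  have [e1 E1 [[B1 V1]|P1]] := IHb true.
    exists (cat [:: true] \o e1); first exact: embedding_comp (embedding_cat _) E1.
    by left; split=> s => /[dup] /B1 ? /V1 ?.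
  exists (join_trees (fun b s => b :: (if b then e1 else e0) s)).
    by apply: embedding_join_cons => -[].
  by right; split=> -[|[] s] //=; rewrite ltnS;
    first [exact: P1.1 | exact: P0.1 | exact: P1.2 | exact: P0.2].
Qed.

(** Inserting [false] before every bit makes all proper extensions of a node leave its image to the
    left. *)
Fixpoint go_left (s : node) : node :=
  if s is b :: s' then false :: b :: go_left s' else [::].

Lemma embedding_go_left : embedding go_left.
Proof.
split; elim=> [|b s IH] [|b' t] //=.
- by rewrite !proper_prefix_cons eqxx => /andP[-> /IH].
- by rewrite !incomparable_cons eqxx => /orP[->|/IH->] //; rewrite orbT.
Qed.

Lemma size_go_left s : size (go_left s) = (size s).*2.
Proof. by elim: s => //= b s ->. Qed.

Lemma go_left_above s t : proper_prefix s t ->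
  prefix (rcons (go_left s) false) (go_left t).
Proof.
elim: s t => [|b s IH] [|b' t]; rewrite ?proper_prefixs0 //.
by rewrite proper_prefix_cons /= => /andP[/eqP-> /IH->]; rewrite !eqxx.
Qed.

Lemma chain_above b h (c : seq node) :
  all (fun t => size t < h.+1) c -> all (prefix [:: b]) c ->
  exists2 c', c = map (cons b) c' & all (fun t => size t < h) c'.
Proof.
elim: c => [|[|b' t] c IH] /=; first by exists [::].
  by [].
rewrite ltnS => /andP[th ch] /andP[/andP[/eqP<- _]].
by case/(IH ch) => c' -> c'h; exists (t :: c') => //=; rewrite th.
Qed.

Lemma chain_map_cons b (c : seq node) : chain (map (cons b) c) = chain c.
Proof.
by apply: mono_sorted => s t; rewrite proper_prefix_cons eqxx.
Qed.

Definition homogeneous_for (M H : nat) (chi : seq node -> bool) e : Prop :=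
  exists k, forall c : seq node, chain c -> size c = M ->
    all (fun s => size s < H) c -> chi (map e c) = k.

(* Fusion: the color of a chain [s :: c] is made to depend only on [s] and on the
   direction in which [c] leaves [s]. *)
Lemma chain_fusion M :
  (forall H, exists N, forall chi, exists e,
     [/\ embedding e, bounded H N e & homogeneous_for M H chi e]) ->
  forall h, exists N, forall chi, exists e (v : node -> bool -> bool),
     [/\ embedding e, bounded h N e & forall s b (c : seq node), chain c -> size c = M ->
       all (fun t => size t < h) c -> all (prefix (rcons s b)) c ->
       size s < h -> chi (map e (s :: c)) = v s b].
Proof.
move=> RM; elim=> [|h [N IH]].
  by exists 0 => chi; exists id, (fun _ _ => true); split.
have [N' hN'] := RM N; exists N'.+1 => chi.
have step b : exists e (v : node -> bool -> bool) k,
    [/\ embedding e, bounded h N' e,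
      forall c : seq node, chain c -> size c = M -> all (fun s => size s < h) c ->
         chi ([::] :: map (cons b \o e) c) = k
    & forall s b' (c : seq node), chain c -> size c = M ->
       all (fun t => size t < h) c -> all (prefix (rcons s b')) c ->
       size s < h -> chi (map (cons b \o e) (s :: c)) = v s b'].
  (* [f] makes constant the color of the chains that start at the root and go in direction [b]; the
     chains starting higher are treated by induction inside the image of [f]. *)
  have [f [Ef Bf [k hk]]] := hN' (fun c => chi ([::] :: map (cons b) c)).
  have [e [v [Ee Be hv]]] := IH (fun c => chi (map (cons b \o f) c)).
  exists (f \o e), v, k; split.
  - exact: embedding_comp.
  - by move=> s /Be/Bf.
  - move=> c cc cM ch; rewrite -(hk (map e c)) ?size_map -?map_comp //.
      exact: embedding_chain.
    by rewrite all_map; apply: sub_all ch => s /Be.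
  - by move=> s b' c cc cM ch cs sh; rewrite -(hv s b' c) //= -map_comp.
have [e0 [v0 [k0 [Ee0 B0 K0 V0]]]] := step false.
have [e1 [v1 [k1 [Ee1 B1 K1 V1]]]] := step true.
exists (join_trees (fun b s => b :: (if b then e1 else e0) s)).
exists (fun s b => if s is b' :: s' then (if b' then v1 else v0) s' b
                   else if b then k1 else k0).
split.
- by apply: embedding_join_cons => -[].
- by move=> -[|[] s] //=; rewrite !ltnS; [move/B1 | move/B0].
- move=> [|b s] b' c cc cM ch cs sh.
    have [c' def_c c'h] := chain_above ch cs.
    move: cc cM; rewrite def_c chain_map_cons size_map /= -map_comp => cc' cM'.
    by case: b' {cs def_c} => /=; [exact: K1 | exact: K0].
  have cs' : all (prefix [:: b]) c.
    by apply: sub_all cs => t; apply: prefix_trans; rewrite rcons_cons prefix_cons eqxx prefix0s.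
  have [c' def_c c'h] := chain_above ch cs'.
  move: cc cM cs; rewrite def_c chain_map_cons size_map all_map /= -map_comp => cc' cM' cs.
  have {}cs : all (prefix (rcons s b')) c'.
    by apply: sub_all cs => t /=; rewrite eqxx.
  by case: b {cs' def_c} sh => /= sh; [apply: (V1 s b' c') | apply: (V0 s b' c')].
Qed.

(* Once every proper extension of a node is sent to its left, the directions in the
   colors given by [chain_fusion] become irrelevant. *)
Lemma chain_ramsey M H : exists N, forall chi, exists e,
  [/\ embedding e, bounded H N e & homogeneous_for M H chi e].
Proof.
elim: M H => [|M IH] H.
  exists H => chi; exists id; split=> //; exists (chi [::]) => c _ /size0nil-> //.
(* [node_ramsey] stays below height [H + H], and [go_left] doubles lengths. *)
have [N hN] := chain_fusion IH (H + H).*2; exists N => chi.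
have [e [v [Ee Be hv]]] := hN chi.
have [f Ef hf] := node_ramsey H H (fun s => v (go_left s) false).
have [k [Bf hk]] : exists k, bounded H (H + H) f /\
    forall s, size s < H -> v (go_left (f s)) false = k.
  by case: hf => -[Bf hf]; [exists true | exists false].
have Egf : embedding (go_left \o f) by apply: embedding_comp embedding_go_left Ef.
have Bgf : bounded H (H + H).*2 (go_left \o f).
  by move=> s /Bf; rewrite /= size_go_left ltn_double.
exists (e \o (go_left \o f)); split.
- exact: embedding_comp.
- by move=> s /Bgf/Be.
- exists k => -[|s c] //= sc [cM] /andP[sH cH]; rewrite -(hk s sH).
  rewrite -(hv (go_left (f s)) false (map (go_left \o f) c)) ?size_map //=.
  + by rewrite -map_comp.
  + exact/(embedding_chain Egf)/(path_sorted sc).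
  + by rewrite all_map; apply: sub_all cH => t /Bgf.
  + apply/allP => _ /mapP[t tc ->]; apply: go_left_above; apply: (proj1 Ef).
    by have /allP := order_path_min (@proper_prefix_trans _) sc; apply.
  + exact: (Bgf s sH).
Qed.

(** * Systems of finite sets of nodes *)

Definition union (X : node -> seq node) (c : seq node) : seq node :=
  flatten [seq X s | s <- c].

Lemma union_map X e (c : seq node) : union X (map e c) = union (X \o e) c.
Proof. by rewrite /union -map_comp. Qed.

Lemma unionP X (c : seq node) x :
  reflect (exists2 s, s \in c & x \in X s) (x \in union X c).
Proof. exact: flatten_mapP. Qed.

Lemma mem_union (X : node -> seq node) (c : seq node) s x :
  s \in c -> x \in X s -> x \in union X c.
Proof. by move=> sc xs; apply/unionP; exists s. Qed.

Lemma union_cons X s c : union X (s :: c) = X s ++ union X c.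
Proof. by []. Qed.

Lemma sub_union X (c d : seq node) :
  {subset c <= d} -> {subset union X c <= union X d}.
Proof. by move=> cd x /unionP[s /cd sd xs]; apply: mem_union xs. Qed.

Lemma size_union k X (c : seq node) : (forall s, size (X s) <= k) ->
  size (union X c) <= size c * k.
Proof.
by move=> Xk; elim: c => //= s c IH; rewrite size_cat mulSn leq_add.
Qed.

(** Thanks to the second clause, a chain inside the sets at two incomparable nodes lies in one of
    the two sets. *)
Definition system (k : nat) (X : node -> seq node) : Prop :=
  (forall s, size (X s) <= k) /\
  (forall s t, incomparable s t ->
     forall x y, x \in X s -> y \in X t -> incomparable x y).

Lemma system_comp k X e : embedding e -> system k X -> system k (X \o e).
Proof. by move=> [_ e2] [X1 X2]; split=> [s|s t /e2]; [apply: X1 | apply: X2]. Qed.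

(** * Extensible and stuck systems *)

Section Consistency.
Variable ok : seq node -> Prop.
Hypothesis ok_sub : forall A B : seq node, {subset A <= B} -> ok B -> ok A.

Definition good (N : nat) (A : seq node) (X : node -> seq node) : Prop :=
  forall c : seq node, chain c -> all (fun s => size s < N) c -> ok (A ++ union X c).

Lemma good_leq N N' A X : N <= N' -> good N' A X -> good N A X.
Proof.
by move=> NN' gA c cc cN; apply: gA => //; apply: sub_all cN => s /leq_trans->.
Qed.

Lemma good_comp N N' A X e : embedding e -> bounded N N' e ->
  good N' A X -> good N A (X \o e).
Proof.
move=> Ee Be gA c cc cN; rewrite -union_map; apply: gA.
  exact: embedding_chain.
by rewrite all_map; apply: sub_all cN => s /Be.
Qed.

Definition extensible (k a M M' : nat) : Prop := forall X A, system k X ->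
  size A <= a -> good M' A X ->
  exists s e, [/\ embedding e, forall t, incomparable s (e t) &
    good M (A ++ X s) (X \o e)].

(** The failure of the conclusion of [extensible] for given [X] and [A]: any tooth together with any
    subtree incomparable with it admits a contradictory chain below height [M]. *)
Definition stuck (M : nat) (A : seq node) (X : node -> seq node) : Prop :=
  forall s e, embedding e -> (forall t, incomparable s (e t)) ->
  exists c : seq node, [/\ chain c, all (fun t => size t < M) c &
    ~ ok (A ++ X s ++ union (X \o e) c)].

Lemma stuck_comp M A X e : embedding e -> stuck M A X -> stuck M A (X \o e).
Proof.
move=> Ee stX s f Ef sf; apply: (stX (e s) (e \o f)); first exact: embedding_comp.
by move=> t; apply: Ee.2.
Qed.

(** Induction on [S]. For one node [s], chains of length [M] are colored by consistency with [A] and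
    [X s]; on a homogeneous subtree the color cannot be [true], since [X] is stuck. *)
Lemma stuck_shrink M j H : M <= H -> exists N, forall A X f (S : seq node),
  stuck M A X -> size S = j -> embedding f ->
  (forall s t : node, s \in S -> incomparable s (f t)) ->
  exists e, [/\ embedding e, bounded H N e &
    forall (s : node) c, s \in S -> chain c -> size c = M -> all (fun t => size t < H) c ->
      ~ ok (A ++ X s ++ union (X \o f \o e) c)].
Proof.
move=> MH; elim: j => [|j IH] in H MH *.
  exists H => A X f S _ /size0nil-> Ef _; exists id; split=> //.
have [N1 R1] := chain_ramsey M H.
(* [N1] levels are needed to apply the Ramsey theorem inside the subtree found for the rest of
   [S]. *)
have [N hN] := IH (maxn M N1) (leq_maxl _ _).
exists N => A X f [|s S] // stX [Sj] Ef Sf.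
have SfS (r t : node) : r \in S -> incomparable r (f t).
  by move=> rS; apply: Sf; rewrite inE rS orbT.
have [e [Ee Be he]] := hN A X f S stX Sj Ef SfS.
pose chi c := `[< ok (A ++ X s ++ union (X \o f \o e) c) >].
have [g [Eg Bg [k hk]]] := R1 chi.
exists (e \o g); split; first exact: embedding_comp.
  by move=> t /Bg tN1; apply: Be; rewrite leq_max tN1 orbT.
(* Stuckness gives a contradictory chain in this subtree; lengthening it to [M] nodes keeps it
   contradictory. *)
have k_false : k = false.
  have Efeg : embedding (f \o e \o g).
    by apply: embedding_comp Eg; apply: embedding_comp.
  have sfeg t : incomparable s ((f \o e \o g) t) by apply: Sf; exact: mem_head.
  have [c [cc cM nok]] := stX s _ Efeg sfeg.
  have [c' [cc' c'M c'lt cc'sub]] := chain_extend cc cM.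
  have c'H : all (fun t => size t < H) c' by apply: sub_all c'lt => t /leq_trans->.
  rewrite -(hk c' cc' c'M c'H); apply/negbTE/asboolP; apply: contra_not nok.
  apply: ok_sub => x; rewrite union_map !mem_cat.
  by case/or3P=> [->|->|/(sub_union cc'sub) ->]; rewrite ?orbT.
move=> t c; rewrite inE => /orP[/eqP->|tS] cc cM cH.
  by have := hk c cc cM cH; rewrite k_false /chi union_map => /asboolPn.
have := he t (map g c) tS; rewrite union_map size_map; apply=> //.
  exact: embedding_chain.
by rewrite all_map; apply: sub_all cH => u /Bg uN1; rewrite /= leq_max uN1 orbT.
Qed.

Fixpoint nodes (N : nat) : seq node :=
  if N is N'.+1 then
    [::] :: [seq false :: s | s <- nodes N'] ++ [seq true :: s | s <- nodes N']
  else [::].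

Lemma mem_nodes N s : (s \in nodes N) = (size s < N).
Proof.
elim: N s => [|N IH] s //=; rewrite inE mem_cat.
case: s => [|b s] //=; rewrite ltnS -IH.
have cons_inj b' : injective (cons b' : node -> node) by move=> ? ? [].
have nocons b1 b2 : b1 != b2 -> (b1 :: s \in [seq b2 :: t | t <- nodes N]) = false.
  by move=> b12; apply/negP => /mapP[t _ [e _]]; rewrite e eqxx in b12.
by case: b; rewrite mem_map // nocons // ?orbF.
Qed.

(* The left subtree is built first; the right one is then taken inside a tree all
   of whose [M.+1]-chains contradict every node already chosen on the left. *)
Lemma stuck_tree M N : exists H, forall A X, stuck M.+1 A X ->
  exists c : node -> seq node,
  [/\ forall s, size s < N -> [/\ chain (c s), size (c s) = M.+1 &
        all (fun x => size x < H) (c s)],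
      forall s t, size t < N -> proper_prefix s t ->
        forall x y, x \in c s -> y \in c t -> proper_prefix x y,
      forall s t, size s < N -> size t < N -> incomparable s t ->
        forall x y, x \in c s -> y \in c t -> incomparable x y &
      forall s t, size s < N -> size t < N -> incomparable s t ->
        ~ ok (A ++ union X (c s) ++ union X (c t))].
Proof.
elim: N => [|N [H IH]]; first by exists 0 => A X _; exists (fun=> [::]); split.
have [H' sh] := @stuck_shrink M.+1 (size (nodes N)) (maxn M.+1 H) (leq_maxl _ _).
(* A node of a subtree has [M.+2] bits from [u] and the direction, followed by a part shorter than
   [H] on the left and [H'] on the right. *)
exists (M.+2 + maxn H H') => A X stX.
(* The chain at the root consists of proper prefixes of [u], so that both subtrees lie above it. *)
pose u : node := nseq M.+1 true.
have cat_s b : embedding (cat (rcons u b)) := embedding_cat _.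
have [c0 [c0_chain c0_pp c0_inc c0_bad]] := IH A _ (stuck_comp (cat_s false) stX).
(* Contradicting one node of each left chain is enough. These chains have length [M.+1], hence
   [head] returns a genuine member. *)
pose S := [seq rcons u false ++ head [::] (c0 s) | s <- nodes N].
have u_inc s t : incomparable (rcons u false ++ s) (rcons u true ++ t).
  by rewrite !cat_rcons incomparable_cat incomparable_cons.
have [||s t /mapP[r _ ->]|e [Ee Be he]] := sh A X (cat (rcons u true)) S stX.
- by rewrite size_map.
- exact: embedding_cat.
- exact: u_inc.
pose f1 := cat (rcons u true) \o e.
have Ef1 : embedding f1 by apply: embedding_comp.
have [c1 [c1_chain c1_pp c1_inc c1_bad]] := IH A _ (stuck_comp Ef1 stX).
pose f b := if b then f1 else cat (rcons u false).
have Ef b : embedding (f b) by case: b; [exact: Ef1 | exact: embedding_cat].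
pose cb b := if b then c1 else c0.
pose c (s : node) := if s is b :: s' then map (f b) (cb b s')
                     else [seq take i u | i <- iota 0 M.+1].
have cnil x : x \in c [::] -> proper_prefix x u.
  case/mapP=> i; rewrite mem_iota add0n => /andP[_ iM] ->.
  rewrite /proper_prefix prefix_take; apply: contraTneq iM => /(congr1 size).
  by rewrite size_take_min size_nseq => /minn_idPr; rewrite -leqNgt.
have u_f b x : prefix u (f b x).
  by case: b; rewrite /f /f1 /= cat_rcons; apply: prefix_prefix.
have inc_f s t : incomparable (f false s) (f true t) by apply: u_inc.
have cross s t : size s < N -> size t < N ->
    ~ ok (A ++ union X (c (false :: s)) ++ union X (c (true :: t))).
  move=> sN tN; have [cs sM _] := c0_chain s sN; have [ct tM tH] := c1_chain t tN.
  have hS : rcons u false ++ head [::] (c0 s) \in S.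
    by apply/mapP; exists s; rewrite ?mem_nodes.
  have tH' : all (fun x => size x < maxn M.+1 H) (c1 t).
    by apply: sub_all tH => x xH; rewrite leq_max xH orbT.
  have -> : union X (c (true :: t)) = union (X \o cat (rcons u true) \o e) (c1 t).
    exact: union_map.
  apply: contra_not (he _ _ hS ct tM tH'); apply: ok_sub => x.
  rewrite !mem_cat => /or3P[->//|xs|->]; last by rewrite !orbT.
  rewrite (mem_union (s := rcons u false ++ head [::] (c0 s))) ?orbT //.
  apply/mapP; exists (head [::] (c0 s)) => //.
  by rewrite /cb; case: (c0 s) sM => //= y l _; apply: mem_head.
exists c; split.
- move=> [_|[] s].
  + split; last first.
    * apply/allP => x xc; have := proper_prefix_size (cnil x xc).
      by rewrite size_nseq => xM; apply: (leq_trans xM); lia.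
    * by rewrite size_map size_iota.
    * by apply: sorted_prefixes; rewrite size_nseq leqW.
  + rewrite /= ltnS => /c1_chain[cs sM sH]; split; last first.
    * rewrite all_map; apply: sub_all sH => x xH /=.
      rewrite size_cat size_rcons size_nseq.
      have : size (e x) < H' by apply: Be; rewrite leq_max xH orbT.
      lia.
    * by rewrite size_map.
    * exact: embedding_chain.
  + rewrite /= ltnS => /c0_chain[cs sM sH]; split; last first.
    * rewrite all_map; apply: sub_all sH => x xH /=.
      rewrite size_cat size_rcons size_nseq; lia.
    * by rewrite size_map.
    * exact: (embedding_chain (Ef false)).
- move=> [|b s] [|b' t]; rewrite ?proper_prefixs0 //.
    move=> tN _ x y xc /mapP[y' _ ->].
    exact: proper_prefix_prefix_trans (cnil x xc) (u_f _ _).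
  rewrite proper_prefix_cons => tN /andP[/eqP<- st] x y /mapP[x' xs ->] /mapP[y' yt ->].
  by apply: (Ef b).1; case: b tN xs yt => tN xs yt; [apply: (c1_pp s t) | apply: (c0_pp s t)].
- move=> [|b s] [|b' t]; rewrite ?incomparable0s ?incomparables0 //.
  rewrite incomparable_cons => sN tN st x y /mapP[x' xs ->] /mapP[y' yt ->].
  have [eb|nb] := eqVneq b b'; last first.
    by case: b b' nb {st xs yt sN tN} => -[] // _; rewrite 1?incomparable_sym; apply: inc_f.
  move: st; rewrite eb eqxx /= => st; rewrite {}eb {b} in sN xs *; apply: (Ef b').2.
  by case: b' sN tN xs yt => sN tN xs yt; [apply: (c1_inc s t) | apply: (c0_inc s t)].
- move=> [|b s] [|b' t]; rewrite ?incomparable0s ?incomparables0 //.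
  rewrite incomparable_cons => sN tN.
  have [<-|nb _] /= := eqVneq b b'.
    move=> st; rewrite /c !union_map.
    by case: b sN tN => sN tN; [apply: c1_bad st | apply: c0_bad st].
  case: b b' nb sN tN => -[] // _ sN tN; last exact: cross.
  apply: contra_not (cross t s tN sN); apply: ok_sub => x.
  by rewrite !mem_cat => /or3P[] ->; rewrite ?orbT.
Qed.

(** Finite form of [SOP2] for a conjunction: the parameters at [s] will be those of all chains in
    [A ++ U s]. The size bound lets one conjunction serve all [N]; the last clause puts each chain
    from [A ++ U s ++ U t] in [A ++ U s] or in [A ++ U t]. *)
Definition sop2_tree (k N : nat) (A : seq node) (U : node -> seq node) : Prop :=
  [/\ forall s, size s < N -> size (A ++ U s) <= k,
      good N A U,
      forall s t, size s < N -> size t < N -> incomparable s t ->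
        ~ ok (A ++ U s ++ U t) &
      forall s t, size s < N -> size t < N -> incomparable s t ->
        forall x y, x \in U s -> y \in U t -> incomparable x y].

Lemma chain_flatten (N : nat) (c : node -> seq node) (d : seq node) :
  (forall s, size s < N -> chain (c s)) ->
  (forall s t, size t < N -> proper_prefix s t ->
        forall x y, x \in c s -> y \in c t -> proper_prefix x y) ->
  chain d -> all (fun s => size s < N) d -> chain (flatten (map c d)).
Proof.
rewrite !(sorted_pairwise (@proper_prefix_trans _)) => cc cpp.
elim: d => //= s d IH /andP[sd dd] /andP[sN dN].
rewrite pairwise_cat IH // andbT -(sorted_pairwise (@proper_prefix_trans _)) cc // andbT.
apply/allrelP => x y xs /flatten_mapP[t td yt].
by apply: (cpp s t) => //; [exact: (allP dN) | exact: (allP sd)].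
Qed.

(** The bound [a + M.+1 * k] does not involve [N]: only the height up to which [A] and [X] are
    consistent grows with [N]. *)
Lemma stuck_sop2 k a M :
  (forall M', exists X A, [/\ system k X, size A <= a, good M' A X & stuck M.+1 A X]) ->
  exists k', forall N, exists A U, sop2_tree k' N A U.
Proof.
move=> hstuck; exists (a + M.+1 * k) => N.
have [H hH] := stuck_tree M N.
have [X [A [sysX Aa gX stX]]] := hstuck H.
have [c [c_chain c_pp c_inc c_bad]] := hH A X stX.
exists A, (fun s => union X (c s)); split=> //.
- move=> s /c_chain[_ <- _]; rewrite size_cat leq_add // size_union //; exact: sysX.1.
- move=> d dd dN.
  have cd : chain (flatten (map c d)).
    by apply: chain_flatten dd dN => // s /c_chain[].
  apply: ok_sub (gX _ cd _).
    move=> x; rewrite !mem_cat => /orP[->//|/unionP[s sd /unionP[t tc xt]]].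
    by rewrite (mem_union (s := t)) ?orbT //; apply/flatten_mapP; exists s.
  apply/allP => x /flatten_mapP[s sd xs].
  by have [_ _ /allP/(_ x xs)] := c_chain s (allP dN s sd).
- move=> s t sN tN st x y /unionP[s' ss' xs'] /unionP[t' tt' yt'].
  by apply: sysX.2 xs' yt'; apply: (c_inc s t).
Qed.

(** * The extensible case: adding teeth at every node *)

Lemma iter_extensible k : (forall a M, exists M', extensible k a M.+1 M') ->
  forall m a M, exists M', forall X A, system k X -> size A <= a -> good M' A X ->
  exists (ts : seq node) e, [/\ size ts = m, embedding e,
    forall t s, t \in ts -> incomparable t (e s), pairwise (@incomparable bool) ts &
    good M (A ++ union X ts) (X \o e)].
Proof.
move=> ext; elim=> [|m IH] a M.
  by exists M => X A _ _ gA; exists [::], id; split; rewrite // cats0.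
(* The first tooth leaves enough levels for the others, which are sought in its subtree and so are
   incomparable with it. It enlarges the fixed set by at most [k]. *)
have [M1 hM1] := IH (a + k) M; have [M' hM'] := ext a M1.
exists M' => X A sysX Aa gA.
have [s [e [Ee se ge]]] := hM' X A sysX Aa gA.
have [|ts [f [sz_ts Ef tsf pts gf]]] := hM1 _ _ (system_comp Ee sysX) _ (good_leq (leqnSn _) ge).
  by rewrite size_cat leq_add //; apply: sysX.1.
exists (s :: map e ts), (e \o f); split.
- by rewrite /= size_map sz_ts.
- exact: embedding_comp.
- move=> t r; rewrite inE => /orP[/eqP->|/mapP[t' t'ts ->]]; first exact: se.
  by apply: Ee.2; apply: tsf.
- rewrite /= all_map; apply/andP; split; first by apply/allP => t _; apply: se.
  by rewrite pairwise_map; apply: sub_pairwise pts => x y; apply: Ee.2.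
- by rewrite union_cons union_map catA.
Qed.

(** The comb 0, 10, 110, and so on. *)
Lemma antichain_exists m : exists ts : seq node, [/\ size ts = m,
  pairwise (@incomparable bool) ts & all (fun t => t != [::]) ts].
Proof.
elim: m => [|m [ts [sz pts _]]]; first by exists [::].
exists ([:: false] :: map (cons true) ts); split.
- by rewrite /= size_map sz.
- rewrite /= all_map; apply/andP; split; first by apply/allP.
  rewrite pairwise_map; apply: sub_pairwise pts => x y /=.
  by rewrite incomparable_cons => ->; rewrite orbT.
- by rewrite /= all_map; apply/allP.
Qed.

(** Above the root a chain stays in one of the two subtrees. Inclusion is enough, as consistency
    passes to subsets. *)
Lemma chain_split (c : seq node) N : chain c -> all (fun s => size s < N.+1) c ->
  exists b c', [/\ chain c', all (fun s => size s < N) c' &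
    {subset c <= [::] :: map (cons b) c'}].
Proof.
have nonempty b (s : node) (d : seq node) : chain ((b :: s) :: d) ->
    all (fun s => size s < N.+1) ((b :: s) :: d) ->
    exists b' d', [/\ chain d', all (fun s => size s < N) d' & (b :: s) :: d = map (cons b') d'].
  move=> cd dN.
  have [|d' def_d d'N] := @chain_above b N _ dN.
    rewrite /= eqxx prefix0s /=.
    apply: sub_all (order_path_min (@proper_prefix_trans _) cd) => t.
    by move/proper_prefixW; apply: prefix_trans; rewrite prefix_cons eqxx prefix0s.
  by exists b, d'; split=> //; rewrite -(chain_map_cons b) -def_d.
case: c => [|[|b s] c] cc cN.
- by exists true, [::]; split.
- case: c cc cN => [|[|b s] c] cc cN.
  + by exists true, [::]; split.
  + by case/andP: cc.
  + have [_ cN'] := andP cN.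
    have [b' [d' [cd' d'N def_c]]] := nonempty _ _ _ (path_sorted cc) cN'.
    by exists b', d'; split=> //; rewrite def_c.
- have [b' [d' [cd' d'N ->]]] := nonempty _ _ _ cc cN.
  by exists b', d'; split=> // x xc; rewrite inE xc orbT.
Qed.

(* [ts s] are the teeth at the node [x s]. *)
Definition toothed (m N : nat) (A : seq node) (X : node -> seq node)
    (x : node -> node) (ts : node -> seq node) : Prop :=
  [/\ embedding x, forall s, size (ts s) = m,
      forall s, pairwise (@incomparable bool) (ts s),
      forall s t, t \in ts s -> proper_prefix (x s) t &
      good N A (fun s => X (x s) ++ union X (ts s))].

(** Recursion from the root: the set at the root and those at its [m] teeth are absorbed into [A],
    and the construction continues in both subtrees with the larger bound [a + k + m * k]. *)
Lemma toothed_exists k m : (forall a M, exists M', extensible k a M.+1 M') ->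
  forall N a, exists M', forall X A, system k X -> size A <= a -> good M' A X ->
  exists x ts, toothed m N A X x ts.
Proof.
move=> ext; elim=> [|N IH] a.
  (* At height 0 only [A] has to be consistent, so any antichain above each node can serve as its
     teeth. *)
  exists 0 => X A _ _ gA.
  have [ts [sz pts ts0]] := antichain_exists m.
  exists id, (fun s => map (cat s) ts); split.
  - exact: embedding_id.
  - by move=> s; rewrite size_map.
  - move=> s; rewrite pairwise_map; apply: sub_pairwise pts => x y /=.
    by rewrite incomparable_cat.
  - move=> s _ /mapP[t tts ->]; rewrite -[s in proper_prefix s _]cats0.
    by rewrite proper_prefix_cat proper_prefix0s (allP ts0).
  - by move=> [|s c] //= _ _; apply: (gA [::]).
have [M1 hM1] := IH (a + k + m * k).
(* One of the [M1.+1] levels is spent on the direction [b]. *)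
have [M2 hM2] := iter_extensible ext m (a + k) M1.+1.
exists M2.+1 => X A sysX Aa gA.
(* The root can be put below any chain; height [M2.+1] leaves room for it even if [M2] is 0. *)
have gA' : good M2 (A ++ X [::]) X.
  move=> c cc cM.
  have [c' [cc' c'M sub]] : exists c', [/\ chain c',
      all (fun s => size s < M2.+1) c' & {subset [::] :: c <= c'}].
    case: c cc cM => [|[|b s] c] cc cM; first by exists [:: [::]]; split.
      exists ([::] :: c); split=> //.
        by move: cM; apply: sub_all => s /ltnW.
      by move=> x; rewrite !inE; case: eqP.
    exists ([::] :: (b :: s) :: c); split=> //.
    by apply/andP; split=> //; apply: sub_all cM => t /ltnW.
  apply: ok_sub (gA _ cc' c'M) => x.
  rewrite -catA !mem_cat => /orP[->//|xc]; apply/orP; right.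
  by apply: sub_union sub _ _; rewrite union_cons mem_cat.
have [|ts0 [e [sz_ts Ee tse pts ge]]] := hM2 X _ sysX _ gA'.
  by rewrite size_cat leq_add // sysX.1.
pose A' := (A ++ X [::]) ++ union X ts0.
pose f b := e \o cons b.
have Ef b : embedding (f b) := embedding_comp Ee (embedding_cat [:: b]).
have gb b : good M1 A' (X \o f b).
  by apply: good_comp ge => //; exact: embedding_cat [:: b].
have sub_b b : exists x ts, toothed m N A' (X \o f b) x ts.
  apply: hM1 (gb b); first exact: system_comp.
  rewrite !size_cat leq_add ?leq_add ?sysX.1 // -sz_ts.
  exact: size_union sysX.1.
have [x0 [t0 T0]] := sub_b false; have [x1 [t1 T1]] := sub_b true.
pose xb b := if b then x1 else x0; pose tb b := if b then t1 else t0.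
have T b : toothed m N A' (X \o f b) (xb b) (tb b) by case: b.
(* The root stays in place, below the teeth [ts0]; both subtrees are placed inside the image of [e],
   which is incomparable with these teeth. *)
exists (join_trees (fun b s => f b (xb b s))).
exists (fun s => if s is b :: s' then map (f b) (tb b s') else ts0).
split.
- apply: embedding_join.
  + by move=> b; have [Eb _ _ _ _] := T b; apply: embedding_comp.
  + move=> b s; rewrite -proper_prefix0s.
    apply: prefix_proper_prefix_trans (prefix0s (e [::])) (Ee.1 _ _ _).
    by rewrite proper_prefix0s.
  + by move=> s t; apply: Ee.2; rewrite incomparable_cons.
- by move=> [|b s] //; rewrite size_map; have [_ sz _ _ _] := T b.
- move=> [|b s] //; have [_ _ p _ _] := T b.
  by rewrite pairwise_map; apply: sub_pairwise (p s) => x y; apply: (Ef b).2.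
- move=> [|b s] t.
    move=> tts /=; rewrite proper_prefix0s.
    by apply: contraTneq (tse t [::] tts) => ->; rewrite incomparable0s.
  by case/mapP=> t' t'ts ->; apply: (Ef b).1; have [_ _ _ p _] := T b; apply: p.
- move=> c cc cN; have [b [c' [cc' c'N sub]]] := chain_split cc cN.
  have [_ _ _ _ gT] := T b; apply: ok_sub (gT c' cc' c'N) => y.
  rewrite !mem_cat => /orP[->//|/unionP[s /sub]].
  rewrite inE => /orP[/eqP->|/mapP[s' s'c ->]] /=.
    by rewrite mem_cat => /orP[] ->; rewrite ?orbT.
  move=> ys; apply/orP; right; apply: (mem_union s'c).
  by rewrite union_map in ys.
Qed.

(** * Excluded copies of the m-ary tree *)

Definition nary (n m : nat) (s : seq nat) : bool :=
  (size s <= n) && all (fun i => i < m) s.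

(** An abstract form of the inconsistency clause of [SOP2'']. Ruling out every [L] that contains the
    sets along the copy avoids listing the tree. *)
Definition excludes (n m : nat) (X : node -> seq node) : Prop :=
  forall h : seq nat -> node,
  (forall s t, nary n m s -> nary n m t -> proper_prefix s t -> proper_prefix (h s) (h t)) ->
  (forall s t, nary n m s -> nary n m t -> incomparable s t -> incomparable (h s) (h t)) ->
  forall L : seq node, (forall s, nary n m s -> {subset X (h s) <= L}) -> ~ ok L.

(** Every node in the new set at [s] comes from a set that [X] attaches at or above [x s], and
    incomparability passes to extensions. *)
Lemma toothed_system k m N A X x ts : system k X -> toothed m N A X x ts ->
  system (k + m * k) (fun s => X (x s) ++ union X (ts s)).
Proof.
move=> sysX [Ex sz _ ab _]; split=> [s|s t st y z].
  rewrite size_cat leq_add ?sysX.1 // -(sz s); exact: size_union sysX.1.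
have above r u : u \in X (x r) ++ union X (ts r) ->
    exists2 v, prefix (x r) v & u \in X v.
  rewrite mem_cat => /orP[ur|/unionP[v /ab/proper_prefixW rv uv]].
    by exists (x r) => //; exact: prefix_refl.
  by exists v.
move=> /above[v sv yv] /above[w tw zw]; apply: sysX.2 yv zw.
exact: incomparable_mono (Ex.2 _ _ st) sv tw.
Qed.

Lemma nary_take n m s : nary n.+1 m s -> nary n m (take n s).
Proof.
case/andP=> _ sm; rewrite /nary size_take_min geq_minl /=.
by apply/allP => i /mem_take; apply: (allP sm).
Qed.

(** A copy [h] of the tree of height [n] extends to a copy [h'] of height [n.+1]: old nodes are
    moved by [x], and the [m] successors of a leaf go to the [m] teeth there. The sets of [X] along
    [h'] are contained in those of the new system along [h]. *)
Lemma toothed_excludes n m N A X x ts : toothed m N A X x ts ->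
  excludes n.+1 m X -> excludes n m (fun s => X (x s) ++ union X (ts s)).
Proof.
move=> [Ex sz pts ab _] exX h hpp hinc L hL.
pose h' s := if size s <= n then x (h s) else nth [::] (ts (h (take n s))) (last 0 s).
have last_lt s : nary n.+1 m s -> (size s <= n) = false -> last 0 s < m.
  case/andP=> _; case/lastP: s => [|s i] //.
  by rewrite all_rcons last_rcons => /andP[].
have tooth s : nary n.+1 m s -> (size s <= n) = false -> h' s \in ts (h (take n s)).
  by move=> ns sn; rewrite /h' sn mem_nth // sz last_lt.
have h'_above s : nary n.+1 m s -> prefix (x (h (take n s))) (h' s).
  move=> ns; case sn: (size s <= n).
    by rewrite /h' sn take_oversize // prefix_refl.
  exact/proper_prefixW/ab/tooth.
have sz_take s : nary n.+1 m s -> (size s <= n) = false -> size s = n.+1.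
  by case/andP=> s1 _ sn; apply/eqP; rewrite eqn_leq s1 ltnNge sn.
apply: (exX h').
- move=> s t ns nt st.
  have sn : size s <= n.
    by rewrite -ltnS; apply: leq_trans (proper_prefix_size st) _; case/andP: nt.
  have ns' : nary n m s by rewrite /nary sn; case/andP: ns.
  case tn: (size t <= n).
    rewrite /h' sn tn; apply/Ex.1/hpp => //.
    by rewrite /nary tn; case/andP: nt.
  apply: prefix_proper_prefix_trans (ab _ _ (tooth t nt tn)).
  rewrite /h' sn; apply: embedding_prefix => //.
  have : prefix s (take n t).
    rewrite prefixE take_takel // -prefixE; exact: proper_prefixW.
  rewrite prefix_eqVproper => /orP[/eqP<-|st']; first exact: prefix_refl.
  by apply/proper_prefixW/hpp => //; apply: nary_take.
- move=> s t ns nt st.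
  have [st'|st'] := boolP (incomparable (take n s) (take n t)).
    apply: incomparable_mono (h'_above _ ns) (h'_above _ nt).
    by apply: Ex.2; apply: hinc => //; apply: nary_take.
  have nle s' t' : nary n.+1 m s' -> nary n.+1 m t' -> incomparable s' t' ->
      prefix (take n s') (take n t') -> size s' <= n -> False.
    move=> ns' nt' inc pr s'n; move: pr; rewrite take_oversize // => pr.
    have := prefix_trans pr (prefix_take t' n).
    by move: inc => /andP[/negbTE->].
  have half s' t' : nary n.+1 m s' -> nary n.+1 m t' -> incomparable s' t' ->
      prefix (take n s') (take n t') ->
      [/\ (size s' <= n) = false, (size t' <= n) = false & take n s' = take n t'].
    move=> ns' nt' inc pr.
    have s'n : (size s' <= n) = false by apply/negP => /(nle _ _ ns' nt' inc pr).
    have e : take n s' = take n t'.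
      move: pr; rewrite prefixE => /eqP <-; rewrite take_oversize //.
      by rewrite !size_take_min (sz_take s') // (minn_idPl (leqnSn n)) geq_minl.
    split=> //; apply/negP => t'n; apply: (nle _ _ nt' ns' _ _ t'n).
      by rewrite incomparable_sym.
    by rewrite e prefix_refl.
  (* Incomparable sequences have comparable truncations only if both are leaves with the same
     parent; then their last entries, and so their teeth, differ. *)
  have [sn tn e] : [/\ (size s <= n) = false, (size t <= n) = false &
      take n s = take n t].
    have : prefix (take n s) (take n t) || prefix (take n t) (take n s).
      by move: st'; rewrite /incomparable -negb_or negbK.
    case/orP=> [/(half _ _ ns nt st) //|/half].
    by rewrite incomparable_sym => /(_ nt ns st) [].
  have lastE r : nary n.+1 m r -> (size r <= n) = false ->
      r = rcons (take n r) (last 0 r).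
    move=> nr rn; have := sz_take r nr rn; case/lastP: r {nr rn} => // r i.
    by rewrite size_rcons last_rcons => -[<-]; rewrite -cats1 take_size_cat // cats1.
  have ne : last 0 s != last 0 t.
    apply: contraTneq st => el.
    have -> : s = t by rewrite (lastE s ns sn) (lastE t nt tn) e el.
    by rewrite /incomparable prefix_refl.
  rewrite /h' sn tn -e.
  have /(pairwiseP [::]) inc_nth := pts (h (take n s)).
  by move: ne; rewrite neq_ltn => /orP[] lt_st; last rewrite incomparable_sym;
    apply: inc_nth => //; rewrite inE sz last_lt.
- move=> s ns y ys; apply: (hL (take n s) (nary_take ns)).
  case sn: (size s <= n).
    by move: ys; rewrite /h' sn mem_cat take_oversize // => ->.
  by rewrite mem_cat (mem_union (tooth s ns sn) ys) orbT.
Qed.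

Theorem tree_dichotomy n k m :
  (forall N, exists X, [/\ system k X, good N [::] X & excludes n m X]) ->
  exists k', forall N, exists A U, sop2_tree k' N A U.
Proof.
elim: n k => [|n IH] k hX.
  (* The tree of height 0 is a single node, and the set at one node is consistent: nothing can be
     excluded. *)
  have [X [_ gX exX]] := hX 1.
  have nil s : nary 0 m s -> s = [::] by case: s.
  case: (exX (fun=> [::]) _ _ (X [::])) => //.
  - by move=> s t /nil-> /nil->.
  - by move=> s t /nil-> /nil->.
  - by move=> s _ y.
  - by rewrite -[X [::]]cats0; apply: (gX [:: [::]]).
have [ext|] := pselect (forall a M, exists M', extensible k a M.+1 M').
  apply: (IH (k + m * k)) => N.
  have [M' hM'] := toothed_exists m ext N 0.
  have [X [sysX gX exX]] := hX M'.
  have [x [ts T]] := hM' X [::] sysX (leqnn _) gX.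
  exists (fun s => X (x s) ++ union X (ts s)); split.
  - exact: toothed_system T.
  - by case: T.
  - exact: toothed_excludes T exX.
(* Failure for some [a] and [M] at every [M'] yields pairs that are stuck at the fixed height [M.+1]
   but consistent up to arbitrary heights. *)
move/existsNP => [a] /existsNP[M] /forallNP noext.
apply: (@stuck_sop2 k a M) => M'.
have /existsNP[X] := noext M'; move=> /existsNP[A] /not_implyP[sysX] /not_implyP[Aa].
move=> /not_implyP[gA nex]; exists X, A; split=> // s e Ee se.
apply: contrapT => /forallNP H; apply: nex; exists s, e; split=> // c cc cM.
apply: contrapT => nok; apply: (H c); split=> //.
by rewrite catA.
Qed.

End Consistency.

(** * Realizing countable sets of formulas in saturated structures *)

Lemma eval_trename L (M : structure L) V W (f : V -> W) (e : W -> M) (t : term L V) :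
  eval e (trename f t) = eval (e \o f) t.
Proof. by elim: t => //= g ts IH; congr fint; apply: funext => i. Qed.

Lemma sat_rename L (M : structure L) V W (f : V -> W) (e : W -> M) (phi : formula L V) :
  sat e (rename f phi) <-> sat (e \o f) phi.
Proof.
elim: phi W f e => {V} [V|V t u|V r ts|V phi IH|V phi IHphi psi IHpsi|V phi IH] W f e //=.
- by rewrite !eval_trename.
- have -> // : (fun i => eval e (trename f (ts i))) = (fun i => eval (e \o f) (ts i)).
  by apply: funext => i; rewrite eval_trename.
- by rewrite IH.
- by rewrite IHphi IHpsi.
- have h x : oapp e x \o omap f = oapp (e \o f) x by apply: funext => -[].
  by split=> -[x]; [rewrite IH h | rewrite -h -IH]; exists x.
Qed.

Lemma copair_comp A B C D (g : C -> D) (f1 : A -> C) (f2 : B -> C) :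
  g \o copair f1 f2 = copair (g \o f1) (g \o f2).
Proof. by apply: funext => -[]. Qed.

Lemma satisfies_instance L (M : structure L) p q (phi : pformula L p q) d b :
  satisfies d (instance (M := M) phi b) <-> sat (copair d b) phi.
Proof. by rewrite /satisfies /instance sat_rename copair_comp. Qed.

(** Only finitely many variables occur. A rank function expresses this for every type of variables,
    since that type changes under quantifiers. *)
Lemma eval_rank L (M : structure L) V (r : V -> nat) (t : term L V) :
  exists B, forall e e' : V -> M, (forall v, r v < B -> e v = e' v) -> eval e t = eval e' t.
Proof.
elim: t => [v|f ts /choice[B hB]].
  by exists (r v).+1 => e e' /(_ v (ltnSn _)).
exists (\max_i B i) => e e' ee' /=; congr fint; apply: funext => i; apply: hB => v vB.
by apply: ee'; apply: leq_trans vB (leq_bigmax i).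
Qed.

Lemma sat_rank L (M : structure L) V (r : V -> nat) (phi : formula L V) :
  exists B, forall e e' : V -> M, (forall v, r v < B -> e v = e' v) ->
    sat e phi -> sat e' phi.
Proof.
have sym V' (r' : V' -> nat) B (P : (V' -> M) -> Prop) :
    (forall e e', (forall v, r' v < B -> e v = e' v) -> P e -> P e') ->
    forall e e', (forall v, r' v < B -> e v = e' v) -> P e' -> P e.
  by move=> h e e' ee'; apply: h => v vB; rewrite ee'.
elim: phi r => {V} [V|V t u|V s ts|V phi IH|V phi IHphi psi IHpsi|V phi IH] r /=.
- by exists 0.
- have [B1 h1] := eval_rank M r t; have [B2 h2] := eval_rank M r u.
  exists (maxn B1 B2) => e e' ee'.
  rewrite (h1 e e') ?(h2 e e') // => v vB; apply: ee'; rewrite leq_max vB ?orbT //.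
- have /choice[B hB] i := eval_rank M r (ts i).
  exists (\max_i B i) => e e' ee'.
  have -> // : (fun i => eval e (ts i)) = (fun i => eval e' (ts i)).
  apply: funext => i; apply: hB => v vB.
  by apply: ee'; apply: leq_trans vB (leq_bigmax i).
- by have [B hB] := IH r; exists B => e e' ee'; apply: contra_not; exact: sym hB _ _ ee'.
- have [B1 h1] := IHphi r; have [B2 h2] := IHpsi r.
  exists (maxn B1 B2) => e e' ee' [s1 s2]; split; [apply: h1 s1 | apply: h2 s2] => v vB;
    by apply: ee'; rewrite leq_max vB ?orbT.
(* The bound variable may get any rank: it has the same value [x] in both assignments. *)
- have [B hB] := IH (oapp r 0); exists B => e e' ee' [x sx]; exists x.
  by apply: hB sx => -[v|] //=; apply: ee'.
Qed.

Lemma sat_fAnd L (M : structure L) V (e : V -> M) (phi psi : formula L V) :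
  sat e (fAnd phi psi) <-> sat e phi /\ sat e psi.
Proof. by []. Qed.

Lemma sat_fNot L (M : structure L) V (e : V -> M) (phi : formula L V) :
  sat e (fNot phi) <-> ~ sat e phi.
Proof. by []. Qed.

(** * Quantifier blocks and finite conjunctions over named variables *)

Section Quantifiers.
Variables (L : language) (M : structure L).
Implicit Types (e : nat -> M) (phi : formula L nat).

Definition update e j x : nat -> M := fun v => if v == j then x else e v.

Definition fEx_at (j : nat) phi : formula L nat :=
  fEx (rename (fun v => if v == j then None else Some v) phi).

Lemma sat_fEx_at e j phi : sat e (fEx_at j phi) <-> exists x, sat (update e j x) phi.
Proof.
have h x : oapp e x \o (fun v => if v == j then None else Some v) = update e j x.
  by apply: funext => v; rewrite /update /=; case: eqP.
rewrite /fEx_at /=; split=> -[x sx]; exists x; first by rewrite -h -sat_rename.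
by rewrite sat_rename h.
Qed.

Definition fExs (l : seq nat) phi : formula L nat := foldr fEx_at phi l.

Lemma sat_fExs e l phi : sat e (fExs l phi) <->
  exists e', (forall v, v \notin l -> e' v = e v) /\ sat e' phi.
Proof.
elim: l e => [|j l IH] e.
  split=> [se|[e' [ee' se']]]; first by exists e.
  by have <- : e' = e by apply: funext => v; apply: ee'.
rewrite [fExs _ _]/= sat_fEx_at; split=> [[x /IH[e' [ee' se']]]|[e' [ee' se']]].
  exists e'; split=> // v; rewrite inE negb_or => /andP[vj vl].
  by rewrite ee' // /update (negbTE vj).
exists (e' j); apply/IH; exists e'; split=> // v vl; rewrite /update.
by case: eqVneq => [->//|vj]; rewrite ee' // inE negb_or vj.
Qed.

Definition fAll (T : eqType) (l : seq T) (F : T -> formula L nat) : formula L nat :=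
  foldr (fun x => fAnd (F x)) fTrue l.

Lemma sat_fAll (T : eqType) e (l : seq T) F :
  sat e (fAll l F) <-> forall x, x \in l -> sat e (F x).
Proof.
elim: l => //= y l IH; split=> [[sy /IH sl] x|h].
  by rewrite inE => /orP[/eqP->|/sl].
split; first exact: h (mem_head _ _).
by apply/IH => x xl; apply: h; rewrite inE xl orbT.
Qed.

End Quantifiers.

(** The range of a sequence is countable, while the equations [v = v] already give infinitely many
    formulas. *)
Lemma card_lt_range L K (M : structure L) (e : nat -> M) :
  card_lt [set: formula L nat] [set: K] -> card_lt (range e) [set: K].
Proof.
apply: contra_not => Ke; apply: card_le_trans Ke _.
apply: card_le_trans (card_image_le e _) _.
pose f n : formula L nat := fEq (tVar L n) (tVar L n).
have f_inj : {in [set: nat] &, injective f} by move=> m n _ _ [].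
by rewrite -(card_le_eql (inj_card_eq f_inj)); apply: subset_card_le.
Qed.

Lemma finite_range_bound T (f : nat -> T) (F : set T) :
  F `<=` range f -> finite_set F ->
  exists N0, forall x, F x -> exists2 N, N <= N0 & f N = x.
Proof.
move=> Ff finF.
have /choice[g hg] x : exists N, F x -> f N = x.
  have [/Ff[N _ <-]|nF] := pselect (F x); first by exists N.
  by exists 0.
have /finite_seqP[s hs] := finite_image g finF.
exists (\max_(i <- s) i) => x Fx; exists (g x); last exact: hg.
apply: leq_bigmax_seq => //.
by have : [set` s] (g x) by rewrite -hs; exists x.
Qed.

(* One value is chosen at a time: the type of the next one quantifies away the later
   variables. *)
Lemma saturated_omega L K (M : structure L) (gamma : nat -> formula L nat) :
  saturated K M -> card_lt [set: formula L nat] [set: K] ->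
  (forall N (e : nat -> M), sat e (gamma N.+1) -> sat e (gamma N)) ->
  (forall N, exists e : nat -> M, sat e (gamma N)) ->
  exists e : nat -> M, forall N, sat e (gamma N).
Proof.
move=> satM large dec sol.
have decn N N' (e : nat -> M) : N <= N' -> sat e (gamma N') -> sat e (gamma N).
  elim: N' => [|N' IH]; first by rewrite leqn0 => /eqP->.
  by rewrite leq_eqVlt ltnS => /orP[/eqP->//|/IH h] /dec.
have /choice[B hB] N := sat_rank M (id : nat -> nat) (gamma N).
(* Each [gamma N] may have its own solution extending the first [i] values; as the formulas
   decrease, one solution serves finitely many of them. *)
pose inv i (e0 : nat -> M) := forall N, exists e : nat -> M,
  (forall j, j < i -> e j = e0 j) /\ sat e (gamma N).
have step i e0 : inv i e0 -> exists x, inv i.+1 (update e0 i x).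
  move=> inv_i.
  pose A := range e0.
  have Ae0 v : e0 v \in A by apply: mem_set; exists v.
  (* The variables after [i] on which [gamma N] depends lie below [B N], hence among the [B N]
     variables quantified here. *)
  pose psi N := fExs (iota i.+1 (B N)) (gamma N).
  pose P N : formula L ('I_1 + A) :=
    rename (fun v => if v == i then inl ord0 else inr (exist _ (e0 v) (Ae0 v))) (psi N).
  pose inj : 'I_1 + A -> 'I_1 + M := copair inl (fun c : A => inr (set_val c)).
  have satP d N : satisfies d (rename inj (P N)) <-> sat (update e0 i (d ord0)) (psi N).
    rewrite /satisfies !sat_rename.
    rewrite (_ : _ \o _ = update e0 i (d ord0)) //.
    by apply: funext => v; rewrite /update /=; case: eqP.
  have [|d hd] := satM A 1 (range P) (card_lt_range large).
    move=> F FP finF.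
    have [|N0 hN0] := @finite_range_bound _ (fun N => rename inj (P N)) F _ finF.
      by move=> phi /FP[_ [N _ <-] <-]; exists N.
    have [e [ee0 se]] := inv_i N0.
    exists (fun=> e i) => phi /hN0[N NN0 <-]; apply/satP/sat_fExs.
    exists (fun v => if v \in iota i.+1 (B N) then e v else update e0 i (e i) v).
    split; first by move=> v /negbTE->.
    apply: hB (decn _ _ _ NN0 se) => v vB; case: ifPn => //.
    rewrite mem_iota negb_and -leqNgt -ltnNge ltnS /update.
    case/orP=> [|iBv]; last by rewrite leqNgt (leq_trans vB) // leq_addl in iBv.
    by rewrite leq_eqVlt; case: eqVneq => [->//|_] /= /ee0.
  exists (d ord0) => N.
  have /satP/sat_fExs[e [ee se]] : satisfies d (rename inj (P N)).
    by apply: hd; exists (P N) => //; exists N.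
  exists e; split=> // j ji; apply: ee; rewrite mem_iota.
  by rewrite ltnNge -ltnS ji.
have step' (ie : nat * (nat -> M)) : exists x, inv ie.1 ie.2 -> inv ie.1.+1 (update ie.2 ie.1 x).
  have [/step[x ?]|ninv] := pselect (inv ie.1 ie.2); first by exists x.
  by exists (ie.2 0).
have [f hf] := choice step'.
have [e00 _] := sol 0.
pose E := fix E i := if i is i'.+1 then update (E i') i' (f (i', E i')) else e00.
have invE i : inv i (E i).
  elim: i => [|i IH] /=; last exact: (hf (i, E i)).
  by move=> N; have [e se] := sol N; exists e.
(* A chosen value never changes later, so the limit agrees with [E (B N)] on all variables that
   matter for [gamma N]. *)
have stable n k : E (n.+1 + k) n = E n.+1 n.
  elim: k => [|k IH]; first by rewrite addn0.
  by rewrite addnS /= /update ltn_eqF ?IH // leq_addr.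
exists (fun n => E n.+1 n) => N.
have [e [ee se]] := invE (B N) N.
apply: hB se => v vB; rewrite ee // -(subnKC vB); exact: stable.
Qed.

(** All parameters of the tree are coded by countably many variables and the tuple [x] is quantified
    away, so that [saturated_omega] produces the infinite tree. *)
Lemma sop2_compactness L K (C : structure L) p Q (psi : pformula L p Q) :
  saturated K C -> card_lt [set: formula L nat] [set: K] ->
  (forall N, exists b : node -> 'I_Q -> C,
     (forall s, size s < N -> exists d, forall i, sat (copair d (b (take i s))) psi) /\
     (forall s t, size s < N -> size t < N -> incomparable s t ->
        ~ exists d, sat (copair d (b s)) psi /\ sat (copair d (b t)) psi)) ->
  exemplifies_SOP2 C psi.
Proof.
move=> satC large sol.
pose T := ('I_p + (seq bool * 'I_Q))%type.
pose var : T -> nat := pickle; pose dec : nat -> option T := @pickle_inv T.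
have varK : pcancel var dec by exact: pickleK_inv.
pose xvar (j : 'I_p) := var (inl j); pose yvar (s : node) (j : 'I_Q) := var (inr (s, j)).
pose at_ s := rename (copair xvar (yvar s)) psi.
pose con (c : seq node) := fExs (map xvar (enum 'I_p)) (fAll c at_).
have sat_con (e : nat -> C) c : sat e (con c) <->
    exists d, forall s, s \in c -> sat (copair d (e \o yvar s)) psi.
  rewrite sat_fExs; split=> [[e' [ee' /sat_fAll se']]|[d hd]].
    exists (e' \o xvar) => s /se'; rewrite sat_rename copair_comp.
    rewrite (_ : e' \o yvar s = e \o yvar s) //.
    apply: funext => j; apply: ee'; apply/negP => /mapP[i _].
    by move/(pcan_inj varK).
  exists (fun v => if dec v is Some (inl j) then d j else e v).
  split.
    move=> v vx; case ev: (dec v) => [[j|?]|] //; move: vx.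
    have <- : xvar j = v by have := @pickle_invK T v; rewrite -/dec ev.
    by rewrite map_f ?mem_enum.
  apply/sat_fAll => s sc; rewrite sat_rename copair_comp.
  rewrite (_ : _ \o xvar = d); last by apply: funext => j; rewrite /= varK.
  rewrite (_ : _ \o yvar s = e \o yvar s); first exact: hd.
  by apply: funext => j; rewrite /= varK.

(* [gamma N] describes the tree below height [N]: the instances at the prefixes of a node are
   jointly satisfiable, those at two incomparable nodes are not. *)
pose gamma N := fAll (nodes N) (fun s =>
  fAnd (con [seq take i s | i <- iota 0 (size s).+1])
       (fAll (nodes N) (fun t => if incomparable s t then fNot (con [:: s; t]) else fTrue))).
have gammaE (e : nat -> C) N : sat e (gamma N) <-> (forall s : node, size s < N ->
    (exists d, forall i, sat (copair d (e \o yvar (take i s))) psi) /\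
    forall t, size t < N -> incomparable s t ->
     ~ exists d, sat (copair d (e \o yvar s)) psi /\ sat (copair d (e \o yvar t)) psi).
  rewrite sat_fAll; split=> h s.
    rewrite -mem_nodes => /h/sat_fAnd[/sat_con[d hd] /sat_fAll ht]; split.
      exists d => i; rewrite -take_minn; apply: hd.
      apply/mapP; exists (minn i (size s)) => //.
      by rewrite mem_iota add0n ltnS geq_minr.
    move=> t tN st [d' [ds dt]].
    have := ht t; rewrite mem_nodes st => /(_ tN)/sat_fNot; apply; apply/sat_con.
    by exists d' => r; rewrite !inE => /orP[] /eqP->.
  rewrite mem_nodes => /h[[d hd] ht]; apply/sat_fAnd; split.
    by apply/sat_con; exists d => _ /mapP[i _ ->].
  apply/sat_fAll => t; rewrite mem_nodes => tN; case: ifP => // st.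
  apply/sat_fNot => /sat_con[d' hd']; apply: (ht t tN st); exists d'.
  by split; apply: hd'; rewrite !inE eqxx ?orbT.
have [N e|N|e he] := saturated_omega satC large (gamma := gamma).
- move/gammaE=> h; apply/gammaE => s sN; have [h1 h2] := h s (ltnW sN).
  by split=> // t tN; apply: h2; apply: ltnW.
- have [b [b1 b2]] := sol N.
  have [e he] : exists e : nat -> C, forall s j, e (yvar s j) = b s j.
    have /inhabited_witness c0 := carrier_inhabited C.
    exists (fun v => if dec v is Some (inr u) then b u.1 u.2 else c0).
    by move=> s j; rewrite varK.
  have {}he s : e \o yvar s = b s by apply: funext => j; apply: he.
  exists e; apply/gammaE => s sN; split.
    by have [d hd] := b1 s sN; exists d => i; rewrite he.
  by move=> t tN st; rewrite !he; apply: b2.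
exists (fun s => e \o yvar s); split.
- move=> eta F Fsub finF.
  (* A finite part of a branch only involves prefixes of a single node, of length [N0]. *)
  have [N0 hN0] := finite_range_bound Fsub finF.
  have /gammaE/(_ (mkseq eta N0))[|[d hd] _] := he N0.+1; first by rewrite size_mkseq.
  exists d => _ /hN0[N NN0 <-]; apply/satisfies_instance.
  have := hd N; rewrite (_ : take N _ = mkseq eta N) //.
  by rewrite /mkseq -map_take take_iota (minn_idPl NN0).
- move=> eta nu inc cons.
  have [d hd] := cons _ (@subset_refl _ _) (finite_set2 _ _).
  have [sN tN] : size eta < (maxn (size eta) (size nu)).+1 /\ size nu < (maxn (size eta) (size nu)).+1.
    by rewrite !ltnS leq_maxl leq_maxr.
  have [_ /(_ nu tN inc)] := iffLR (gammaE e _) (he _) eta sN; apply.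
  by exists d; split; apply/satisfies_instance; apply: hd; [left | right].
Qed.

(** * From [SOP2''] to [SOP2] *)

Lemma sat_conj_power L (M : structure L) p q (phi : pformula L p q) k
    (d : 'I_p -> M) (B : 'I_(k * q) -> M) :
  sat (copair d B) (conj_power phi k) <->
  forall l, sat (copair d (fun j => B (cat_index l j))) phi.
Proof.
have big (r : seq 'I_k) (F : 'I_k -> formula L ('I_p + 'I_(k * q))) e :
    sat e (\big[@fAnd L _/fTrue]_(l <- r) F l) <-> forall l, l \in r -> sat (M := M) e (F l).
  elim: r => [|l0 r IH]; first by rewrite big_nil.
  rewrite big_cons sat_fAnd IH; split=> [[h0 h] l|h].
    by rewrite inE => /orP[/eqP->|/h].
  split; first exact: h (mem_head _ _).
  by move=> l lr; apply: h; rewrite inE lr orbT.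
rewrite /conj_power big; split=> h l => [|_].
  by have := h l (mem_index_enum _); rewrite sat_rename copair_comp.
by rewrite sat_rename copair_comp; apply: h.
Qed.

Lemma cat_index_inj k q : injective (fun lj : 'I_k * 'I_q => cat_index lj.1 lj.2).
Proof.
move=> [l j] [l' j'] /= /(congr1 val) /= e.
have q_gt0 : 0 < q by apply: leq_ltn_trans (ltn_ord j).
have ll' : l = l'.
  apply/val_inj; have := congr1 (divn^~ q) e.
  by rewrite /= !divnMDl // !divn_small // !addn0.
move: e; rewrite -{l'}ll' => /eqP; rewrite eqn_add2l => /eqP jj'.
by congr pair; apply: val_inj.
Qed.

Lemma flatten_blocks (T : Type) (x0 : T) k q (b : 'I_k -> 'I_q -> T) :
  exists B : 'I_(k * q) -> T, forall l j, B (cat_index l j) = b l j.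
Proof.
exists (fun i => if [pick lj : 'I_k * 'I_q | cat_index lj.1 lj.2 == i] is Some lj
                 then b lj.1 lj.2 else x0) => l j.
case: pickP => [[l' j'] /= /eqP e|/(_ (l, j))]; last by rewrite eqxx.
by have [-> ->] := @cat_index_inj k q (l', j') (l, j) e.
Qed.

Lemma consistent_sub L (M : structure L) X (P Q : set (formula L (X + M))) :
  P `<=` Q -> consistent Q -> consistent P.
Proof. by move=> PQ cQ F FP; apply: cQ; apply: subset_trans PQ. Qed.

(** * Successors below an infinite cardinal *)

Section Ordinals.
Variables (d : Order.disp_t) (W : orderType d).
Hypothesis cardW : infinite_cardinal W.

(** An infinite cardinal is a limit ordinal: below a last element [a] there would be infinitely many
    elements, and shifting a copy of the natural numbers would inject all of [W] among them. *)
Lemma cardinal_no_max (a : W) : exists b : W, (a < b)%O.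
Proof.
have [_ infW card_seg] := cardW; apply: contrapT => /forallNP nob.
have maxa v : (v < a)%O = (v != a).
  by rewrite lt_neqAle [(v <= a)%O]leNgt (introN idP (nob v)) andbT.
pose S := [set v : W | (v < a)%O].
apply: (card_seg a).
have infS : infinite_set S.
  rewrite (_ : S = [set: W] `\ a); first exact: infinite_setD (finite_set1 a).
  by apply/seteqP; split=> v; rewrite /S /= maxa; [move/eqP | case=> _ /eqP].
have /card_leP[g'] : [set: nat] #<= S by apply/infiniteP.
pose g n : W := set_val (g' (exist _ n (mem_set I))).
have gS n : g n != a.
  by rewrite -maxa; apply: (set_mem (valP (g' (exist _ n (mem_set I))))).
have g_inj : injective g.
  by move=> i j /val_inj/(@inj _ _ _ g') gij; case: (gij (mem_set I) (mem_set I)).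
(* The shift: [a] takes the place of [g 0], each [g n] moves to [g n.+1], and everything else is
   fixed. *)
have /choice[f hf] v : exists x, [/\ v = a -> x = g 0, forall n, v = g n -> x = g n.+1 &
    v <> a -> (forall n, v <> g n) -> x = v].
  have [->|va] := eqVneq v a.
    by exists (g 0); split=> // n /esym/eqP; rewrite (negbTE (gS n)).
  have [[n ->]|ng] := pselect (exists n, v = g n).
    exists (g n.+1); split=> [|m /g_inj->//|_ /(_ n)//].
    by move/eqP; rewrite (negbTE (gS n)).
  exists v; split=> //; first by move/eqP: va.
  by move=> n e; case: ng; exists n.
have f_cases v : (v = a /\ f v = g 0) \/ (exists2 n, v = g n & f v = g n.+1) \/
    [/\ v <> a, forall n, v <> g n & f v = v].
  have [f0 fS fid] := hf v.
  have [va|/eqP va] := eqVneq v a; first by left; split=> //; exact: f0.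
  have [[n vn]|ng] := pselect (exists n, v = g n).
    by right; left; exists n => //; exact: fS.
  right; right; have ng' n : v <> g n by move=> e; case: ng; exists n.
  by split=> //; exact: fid.
have f_inj : {in [set: W] &, injective f}.
  move=> u v _ _; case: (f_cases u) => [[-> ->]|[[n -> ->]|[ua ug ->]]];
    case: (f_cases v) => [[-> ->]|[[m -> ->]|[va vg ->]]] //.
  - by move/g_inj.
  - by move=> e; case: (vg 0).
  - by move/g_inj.
  - by move/g_inj=> [->].
  - by move=> e; case: (vg n.+1).
  - by move=> e; case: (ug 0).
  - by move=> e; case: (ug m.+1).
rewrite -(card_le_eql (inj_card_eq f_inj)); apply: subset_card_le.
move=> _ [v _ <-] /=; rewrite /S /= maxa.
by case: (f_cases v) => [[_ ->]|[[n _ ->]|[/eqP va _ ->]]].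
Qed.

Lemma successor_exists (a : W) : exists b, succ_of a b.
Proof.
have [b0 ab0] := cardinal_no_max a; have [wo _ _] := cardW.
have [|b [[ab bmin] _]] := wo [pred v : W | (a < v)%O]; first by exists b0.
exists b; split=> // v; rewrite negb_and; case: (boolP (a < v)%O) => //= av.
by rewrite -leNgt; apply: bmin.
Qed.

Lemma successor_sequence : exists w : nat -> W, forall i, succ_of (w i) (w i.+1).
Proof.
have [_ /infinite_setN0[w0 _] _] := cardW.
have /choice[S hS] := successor_exists.
by exists (fun i => iter i S w0) => i; apply: hS.
Qed.

End Ordinals.

(** * Coding finite binary nodes by sequences of successor length *)

Section Nodes.
Variables (d : Order.disp_t) (W : orderType d) (w : nat -> W).
Hypothesis w_succ : forall i, succ_of (w i) (w i.+1).

Lemma w_lt i j : (w i < w j)%O = (i < j).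
Proof.
have homo : {homo w : i j / i < j >-> (i < j)%O}.
  by apply: homo_ltn => [|k]; [exact: lt_trans | case: (w_succ k)].
have [/homo ij|] := ltnP i j; first by rewrite ij.
rewrite leq_eqVlt => /orP[/eqP->|/homo]; first by rewrite ltxx.
by move/ltW; rewrite leNgt => /negbTE.
Qed.

Lemma w_inj : injective w.
Proof.
by move=> i j e; case: (ltngtP i j) => //; rewrite -w_lt e ltxx.
Qed.

(** The value is [false] off the points coding [s], so that [bits s] is also a full branch through
    the codes of all prefixes of [s]. *)
Definition bits (s : node) (v : W) : bool :=
  `[< exists2 j, v = w j.+1 & nth false s j >].

(* The value at [w 0] is junk, so that the empty node has successor length too. *)
Definition dseq_of (s : node) : dseq W := restr (bits s) (w (size s).+1).

Lemma bitsE s j : bits s (w j.+1) = nth false s j.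
Proof.
by apply/asboolP/idP => [[i /w_inj[->]]|sj] //; exists j.
Qed.

Lemma bits_prefix s t v : prefix s t -> (v < w (size s).+1)%O -> bits s v = bits t v.
Proof.
case/prefixP=> u -> vs; apply: asbool_equiv_eq; split=> -[j vj sj]; exists j => //;
  by move: sj; rewrite nth_cat -w_lt; move: vs; rewrite vj !w_lt ltnS => ->.
Qed.

Lemma prefix_initial s t : prefix s t -> initial (dseq_of s) (dseq_of t).
Proof.
move=> st; split=> /= [|v hs ht]; last exact: bits_prefix.
by rewrite leNgt w_lt -leqNgt ltnS size_prefix.
Qed.

Lemma initial_prefix s t : initial (dseq_of s) (dseq_of t) -> prefix s t.
Proof.
case=> /=; rewrite leNgt w_lt -leqNgt ltnS => st h.
rewrite prefixE; apply/eqP/(@eq_from_nth _ false); first by rewrite size_takel.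
rewrite size_takel // => j js; rewrite nth_take // -!bitsE.
by rewrite -(h (w j.+1)) // w_lt ltnS // (leq_trans js).
Qed.

Lemma proper_prefix_initial s t :
  proper_prefix s t -> proper_initial (dseq_of s) (dseq_of t).
Proof.
move=> st; split; first exact/prefix_initial/proper_prefixW.
by rewrite /= w_lt ltnS proper_prefix_size.
Qed.

Lemma incomparable_dseq s t :
  incomparable s t -> dincomparable (dseq_of s) (dseq_of t).
Proof. by case/andP=> st ts; split; apply: contra_not (@initial_prefix _ _) _; apply/negP. Qed.

Lemma is_successor_dseq s : is_successor (lg (dseq_of s)).
Proof. by exists (w (size s)); apply: w_succ. Qed.

Lemma dchain_eq n (c c' : dchain W n) : (forall i, c i = c' i) -> c = c'.
Proof.
case: c c' => [e s l] [e' s' l'] /= ee'.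
have {}ee' : e = e' by apply: funext.
by case: _ / ee' in s' l' *; congr DChain; apply: Prop_irrelevance.
Qed.

Definition chain_in n (L : seq node) (c : dchain W n) : Prop :=
  forall i, exists2 s, s \in L & c i = dseq_of s.

(** The length of the list depends only on [n] and [k]: chains are listed through the functions from
    positions to entries of [L], and functions that give no chain are sent to [c0]. *)
Lemma chain_in_enum n k (L : seq node) (c0 : dchain W n) :
  size L <= k -> chain_in L c0 ->
  exists f : 'I_(#|{ffun 'I_n.+1 -> 'I_k}|) -> dchain W n,
    forall c, chain_in L c <-> exists l, f l = c.
Proof.
move=> Lk c0L.
have /choice[g hg] (F : {ffun 'I_n.+1 -> 'I_k}) : exists c : dchain W n, chain_in L c /\
    forall c', chain_in L c' -> (forall i, c' i = dseq_of (nth [::] L (F i))) -> c' = c.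
  have [[c [cL cF]]|noc] := pselect (exists c, chain_in L c /\
      forall i, c i = dseq_of (nth [::] L (F i))).
    exists c; split=> // c' _ c'F; apply: dchain_eq => i.
    by rewrite c'F cF.
  by exists c0; split=> // c' c'L c'F; case: noc; exists c'.
exists (fun l => g (enum_val l)) => c; split=> [cL|[l <-]]; last by have [] := hg (enum_val l).
have /choice[j hj] i : exists j : 'I_k, c i = dseq_of (nth [::] L j).
  have [s sL ->] := cL i.
  have sk : index s L < k by apply: leq_trans Lk; rewrite index_mem.
  by exists (Ordinal sk); rewrite /= nth_index.
exists (enum_rank [ffun i => j i]); rewrite enum_rankK; apply/esym.
by apply: (hg _).2 => // i; rewrite ffunE.
Qed.

Lemma finite_chain_in n (L : seq node) : finite_set [set c : dchain W n | chain_in L c].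
Proof.
have [[c0 c0L]|noc] := pselect (exists c : dchain W n, chain_in L c); last first.
  rewrite (_ : [set c | _] = set0) //; apply/seteqP; split=> // c cL.
  by case: noc; exists c.
have [f hf] := chain_in_enum (leqnn _) c0L.
rewrite (_ : [set c | _] = range f); first exact/finite_image/finite_finset.
by apply/seteqP; split=> c /= => [/hf[l <-]|[l _ <-]]; [exists l | apply/hf; exists l].
Qed.

(** Entries of a chain are comparable, so once one comes from [V] none can come from [U]. *)
Lemma chain_in_cat n (A U V : seq node) (c : dchain W n) :
  (forall x y, x \in U -> y \in V -> incomparable x y) ->
  chain_in (A ++ U ++ V) c -> chain_in (A ++ U) c \/ chain_in (A ++ V) c.
Proof.
move=> UV cL; have [|nU] := pselect (chain_in (A ++ U) c); [by left | right].
have /existsNP[i niU] := nU.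
have [x xV cx] : exists2 x, x \in V & c i = dseq_of x.
  have [x xL cx] := cL i; exists x => //.
  move: xL; rewrite catA mem_cat => /orP[xAU|//].
  by case: niU; exists x.
move=> j; have [y yL cy] := cL j; exists y => //.
move: yL; rewrite !mem_cat => /or3P[->//|yU|->]; last by rewrite orbT.
have /incomparable_dseq[yx xy] := UV _ _ yU xV.
have [ij|ji|ij] := ltngtP (i : nat) j.
- by case: xy; rewrite -cx -cy; have [] := entry_lt c ij.
- by case: yx; rewrite -cx -cy; have [] := entry_lt c ji.
- case: xy; rewrite -cx -cy (val_inj ij).
  by split=> // v hs ht; congr (c j _); congr exist; apply: Prop_irrelevance.
Qed.

Lemma chain_in_branch n (c : seq node) (u : node) (b : dchain W n) :
  {in c, forall s, prefix s u} -> chain_in c b -> branch_chain (n := n) (bits u) b.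
Proof.
move=> cu cb; have /choice[s hs] i : exists s, s \in c /\ b i = dseq_of s.
  by have [s sc bs] := cb i; exists s.
exists (fun i => w (size (s i))); split=> [i j ij|i].
  have [_] := entry_lt b ij; rewrite (hs i).2 (hs j).2 /= !w_lt ltnS; exact.
exists (w (size (s i)).+1); first exact: w_succ.
rewrite (hs i).2 /dseq_of /restr; congr DSeq; apply: funext => v.
by apply: bits_prefix (valP v); apply: cu; case: (hs i).
Qed.

End Nodes.

Lemma proper_prefix_map (T U : eqType) (f : T -> U) (s t : seq T) : injective f ->
  proper_prefix (map f s) (map f t) = proper_prefix s t.
Proof.
move=> f_inj; rewrite /proper_prefix !prefixE size_map -map_take.
by rewrite !(inj_eq (inj_map f_inj)).
Qed.

Lemma incomparable_map (T U : eqType) (f : T -> U) (s t : seq T) : injective f ->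
  incomparable (map f s) (map f t) = incomparable s t.
Proof.
move=> f_inj; rewrite /incomparable !prefixE !size_map -!map_take.
by rewrite !(inj_eq (inj_map f_inj)).
Qed.

(** * Realizability of finite sets of nodes and the resulting trees *)

Section FromSOP2''.
Variables (L : language) (C : structure L) (p q : nat) (theta : pformula L p q).
Variables (n : nat) (d : Order.disp_t) (W : orderType d) (w : nat -> W).
Variable a : dchain W n -> 'I_q -> C.
Hypothesis w_succ : forall i, succ_of (w i) (w i.+1).
Hypothesis branch_consistent : forall eta : W -> bool,
  consistent [set instance theta (a c) | c in branch_chain (n := n) eta].
Variable m : nat.
Hypothesis embedding_inconsistent :
  forall h : n.-bseq 'I_m -> dseq W, tree_embedding h ->
  ~ consistent [set instance theta (a c)
      | c in [set c : dchain W n | exists eta : n.-tuple 'I_m, image_chain h eta c]].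

(** The notion [ok] to which the dichotomy is applied. A finite set contains finitely many chains,
    so consistency amounts to a single realization. *)
Definition realizable (A : seq node) : Prop :=
  exists e : 'I_p -> C, forall c, chain_in w A c -> sat (copair e (a c)) theta.

Lemma realizable_sub (A B : seq node) :
  {subset A <= B} -> realizable B -> realizable A.
Proof.
move=> AB [e he]; exists e => c cA; apply: he => i.
by have [s sA cs] := cA i; exists s => //; apply: AB.
Qed.

Lemma realizable_chain (c : seq node) (u : node) :
  {in c, forall s, prefix s u} -> realizable c.
Proof.
move=> cu; pose F := [set instance theta (a b) | b in [set b | chain_in w c b]].
have [||e he] := @branch_consistent (bits w u) F.
- by move=> _ [b bc <-]; exists b => //; apply: chain_in_branch bc.
- by apply: finite_image; apply: finite_chain_in.
by exists e => b bc; apply/satisfies_instance; apply: he; exists b.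
Qed.

Lemma singletons_good N : good realizable N [::] (fun s => [:: s]).
Proof.
move=> c cc _; rewrite cat0s /union flatten_map1 map_id.
case: c cc => [_|s c cc]; first by apply: (realizable_chain (u := [::])).
exact/realizable_chain/chain_prefix_last.
Qed.

(** Through [dseq_of], a copy of the [m]-ary tree among binary nodes becomes a tree embedding, whose
    instances are inconsistent by hypothesis. *)
Lemma singletons_exclude : excludes realizable n m (fun s => [:: s]).
Proof.
move=> h hpp hinc A hA [e he].
pose h' (s : n.-bseq 'I_m) := dseq_of w (h (map val s)).
have nary_val (s : n.-bseq 'I_m) : nary n m (map val s).
  rewrite /nary size_map size_bseq; apply/allP => _ /mapP[i _ ->]; exact: ltn_ord.
have h'pp (s t : n.-bseq 'I_m) : proper_prefix s t -> proper_initial (h' s) (h' t).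
  move=> st; apply: proper_prefix_initial => //; apply: hpp => //.
  by rewrite proper_prefix_map //; apply: val_inj.
have h'inc (s t : n.-bseq 'I_m) : incomparable s t -> dincomparable (h' s) (h' t).
  move=> st; apply: incomparable_dseq => //; apply: hinc => //.
  by rewrite incomparable_map //; apply: val_inj.
apply: (@embedding_inconsistent h').
  split=> // [s t hst|s]; last exact: is_successor_dseq.
  (* Injectivity follows from preservation: distinct sequences are incomparable or one properly
     extends the other. *)
  have [st|st] := boolP (incomparable s t).
    by have := h'inc _ _ st; rewrite hst => -[[]]; split=> // v hs ht; congr (h' t _); congr exist; apply: Prop_irrelevance.
  apply/val_inj/eqP; apply: contraT => nst.
  move: st; rewrite /incomparable negb_and !negbK => /orP[] st.
    have [_] : proper_initial (h' s) (h' t) by apply: h'pp; rewrite /proper_prefix st.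
    by rewrite hst ltxx.
  have [_] : proper_initial (h' t) (h' s).
    by apply: h'pp; rewrite /proper_prefix st eq_sym.
  by rewrite hst ltxx.
move=> F FP _; exists e => _ /FP[c [eta hc] <-]; apply/satisfies_instance/he => l.
have sz : size (take l eta) <= n by rewrite size_take_min geq_min size_tuple leqnn orbT.
exists (h (map val (Bseq sz))); last exact: (hc l (Bseq sz)).
by apply: (hA _ (nary_val _)); rewrite inE.
Qed.

Lemma singletons_system : system 1 (fun s => [:: s]).
Proof. by split=> // s t st x y; rewrite !inE => /eqP-> /eqP->. Qed.

(** The exponent [k] counts the functions from the [n.+1] positions of a chain to [k0] nodes, and so
    is the same for all [N]. *)
Lemma conj_power_tree : exists k, forall N, exists b : node -> 'I_(k * q) -> C,
  (forall s, size s < N ->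
     exists e, forall i, sat (copair e (b (take i s))) (conj_power theta k)) /\
  (forall s t, size s < N -> size t < N -> incomparable s t ->
     ~ exists e, sat (copair e (b s)) (conj_power theta k) /\
                 sat (copair e (b t)) (conj_power theta k)).
Proof.
have [|k0 htree] := @tree_dichotomy _ realizable_sub n 1 m.
  move=> N; exists (fun s => [:: s]); split.
  - exact: singletons_system.
  - exact: singletons_good.
  - exact: singletons_exclude.
exists #|{ffun 'I_n.+1 -> 'I_k0}| => N; set k := #|_|.
(* The tree is taken above [false], in one of height [N.+1]; the node [[:: true]] is kept to show
   that every [Z s] contains a chain. *)
have [A [U [szU gU badU incU]]] := htree N.+1.
have c0 : C by apply: inhabited_witness; apply: carrier_inhabited.
pose Z s := A ++ U (false :: s).
have okA s : size s < N.+1 -> realizable (A ++ U s).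
  move=> sN; have := gU [:: s]; rewrite union_cons cats0 /=; apply=> //.
  by rewrite sN.
have nonempty s : size s < N -> exists c : dchain W n, chain_in w (Z s) c.
  (* Otherwise all chains in [A], [U (false :: s)] and [U [:: true]] would lie in [A ++ U
     [:: true]], which is realizable. *)
  move=> sN; apply: contrapT => /forallNP nos.
  have tN : size [:: true] < N.+1 by rewrite ltnS (leq_ltn_trans _ sN).
  have fsN : size (false :: s) < N.+1 by [].
  have ist : incomparable (false :: s) [:: true] by rewrite incomparable_cons.
  apply: (badU _ _ fsN tN ist); have [e he] := okA _ tN; exists e => c.
  move=> cL; have [csZ|] := chain_in_cat w_succ (incU _ _ fsN tN ist) cL; last exact: he.
  by case: (nos c).
(* The [k] blocks list the parameters of all chains in [Z s], possibly with repetitions. *)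
have /choice[b hb] s : exists bs : 'I_(k * q) -> C, size s < N ->
    forall e : 'I_p -> C, sat (copair e bs) (conj_power theta k) <->
    forall c, chain_in w (Z s) c -> sat (copair e (a c)) theta.
  have [sN|_] := ltnP (size s) N; last by exists (fun=> c0).
  have [cs csZ] := nonempty s sN.
  have [f hf] := chain_in_enum (szU (false :: s) sN) csZ.
  have [B hB] := flatten_blocks c0 (fun l => a (f l)).
  exists B => _ e; rewrite sat_conj_power.
  have -> : (forall l, sat (copair e (fun j => B (cat_index l j))) theta) <->
            (forall l, sat (copair e (a (f l))) theta).
    by split=> h l; have := h l; rewrite (_ : (fun j => B _) = a (f l)) //;
      apply: funext => j; rewrite hB.
  by split=> [h c /hf[l <-]|h l]; [apply: h | apply/h/hf; exists l].
exists b; split=> [s sN|s t sN tN st [e [/(hb s sN) es /(hb t tN) et]]].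
  pose c := [seq false :: take i s | i <- iota 0 (size s).+1].
  have [||e he] := gU c.
  - rewrite /c (map_comp (cons false) (take^~ s)) chain_map_cons.
    exact: sorted_prefixes.
  - apply/allP => _ /mapP[i _ ->]; rewrite /= ltnS (leq_ltn_trans _ sN) //.
    by rewrite size_take_min geq_minr.
  exists e => i; apply/hb; first by rewrite (leq_ltn_trans _ sN) // size_take_min geq_minr.
  move=> b' b'Z; apply: he => j; have [x xZ bx] := b'Z j; exists x => //.
  move: xZ; rewrite !(mem_cat x A) => /orP[->//|xU]; apply/orP; right.
  apply: (mem_union (s := false :: take i s)) => //; apply/mapP; exists (minn i (size s)).
    by rewrite mem_iota ltnS geq_minr.
  by rewrite take_minn.
apply: (badU (false :: s) (false :: t)) => //.
exists e => c cL; have [x y xs yt|cs|ct] := chain_in_cat w_succ _ cL.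
- exact: (incU (false :: s) (false :: t)).
- exact: es.
- exact: et.
Qed.

End FromSOP2''.

(** * From [SOP2] to [SOP2''] *)

Lemma infinite_cardinal_nat : infinite_cardinal nat.
Proof.
split.
- apply: antisymmetric_well_order; first exact: le_anti.
  move=> A [x xA]; have exA : exists x, x \in A by exists x.
  case: (ex_minnP exA) => z zA zmin; exists z; split=> // y yA; exact: zmin.
- exact: infinite_nat.
- move=> a /card_le_finite h; apply: infinite_nat; apply: h.
  exact: sub_finite_set (finite_II a).
Qed.

(** Made total by [false], so that [mkseq] can list the values below [lg s]. *)
Definition dvalue (s : dseq nat) (v : nat) : bool :=
  match pselect (v < lg s)%O with
  | left vs => s (exist _ v vs)
  | right _ => false
  end.

Definition seq_of (s : dseq nat) : node := mkseq (dvalue s) (lg s).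

Lemma dvalueE (s : dseq nat) v (vs : (v < lg s)%O) : dvalue s v = s (exist _ v vs).
Proof.
rewrite /dvalue; case: pselect => // vs'; congr (s _); congr exist.
exact: Prop_irrelevance.
Qed.

Lemma seq_of_restr eta b : seq_of (restr eta b) = mkseq eta b.
Proof.
apply/(@eq_from_nth _ false); rewrite !size_mkseq // => v vb.
by rewrite !nth_mkseq // dvalueE.
Qed.

Lemma prefix_seq_of s t : prefix (seq_of s) (seq_of t) -> initial s t.
Proof.
move=> st; have := size_prefix st; rewrite !size_mkseq => szst.
split=> // v hs ht; case/prefixP: st => u e.
have := congr1 (nth false ^~ v) e; rewrite /= nth_cat size_mkseq.
have -> : v < lg s by [].
by rewrite !nth_mkseq // !dvalueE.
Qed.

Lemma incomparable_seq_of s t :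
  dincomparable s t -> incomparable (seq_of s) (seq_of t).
Proof.
by case=> st ts; apply/andP; split; apply/negP => /prefix_seq_of.
Qed.

Lemma embedding_chain_entry d (W : orderType d) n m (h : n.-bseq 'I_m -> dseq W)
    (eta : n.-tuple 'I_m) : tree_embedding h ->
  exists c : dchain W n, image_chain h eta c.
Proof.
move=> [_ h_succ h_pp _].
have sz l : size (take l eta) <= n by rewrite size_take_min geq_min size_tuple leqnn orbT.
have lt_entry (i j : 'I_n.+1) : (i < j)%N ->
    proper_initial (h (Bseq (sz i))) (h (Bseq (sz j))).
  move=> ij; apply: h_pp => /=; rewrite /proper_prefix.
  have -> : take i eta = take i (take j eta) by rewrite take_takel // ltnW.
  rewrite prefix_take /=; apply: contraTneq ij => /(congr1 size).
  have jn : j <= size eta by rewrite size_tuple -ltnS.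
  by rewrite size_take_min (size_takel jn) => /minn_idPr; rewrite leqNgt.
exists (DChain (fun i => h_succ (Bseq (sz i))) lt_entry) => l s sl /=.
by congr h; apply: val_inj.
Qed.

Lemma sop2_sop2'' L (C : structure L) p q (theta : pformula L p q) :
  exemplifies_SOP2 C theta -> exemplifies_SOP2'' C theta.
Proof.
move=> [a [a_branch a_inc]].
exists 1, _, nat; split; first exact: infinite_cardinal_nat.
exists (fun c => a (seq_of (c ord_max))); split.
  move=> eta; apply: consistent_sub (a_branch eta) => _ [c [alpha [_ hc]] <-].
  have [b _ ->] := hc ord_max; rewrite seq_of_restr.
  by exists b.
(* From two branches on, the tree of height 1 has two incomparable leaves. *)
exists 2 => m m2 h h_emb cons.
pose i0 : 'I_m := Ordinal (leq_trans (isT : 0 < 2) m2).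
pose i1 : 'I_m := Ordinal m2.
have [c0 hc0] := embedding_chain_entry [tuple i0] h_emb.
have [c1 hc1] := embedding_chain_entry [tuple i1] h_emb.
have [_ _ _ h_inc] := h_emb.
have inc : incomparable (seq_of (c0 ord_max)) (seq_of (c1 ord_max)).
  apply: incomparable_seq_of.
  rewrite (hc0 ord_max [bseq i0]) // (hc1 ord_max [bseq i1]) //.
  by apply: h_inc; rewrite incomparable_cons.
apply: (a_inc _ _ inc); apply: consistent_sub cons => _ [->|->].
- by exists c0 => //; exists [tuple i0].
- by exists c1 => //; exists [tuple i1].
Qed.

Theorem theorem3p13 (L : language) (T : set (sentence L)) (K : Type)
    (C : structure L) (hT : complete_theory T) (hC : monster T K C) :
  (forall (p q : nat) (theta : pformula L p q),
     exemplifies_SOP2 C theta -> exemplifies_SOP2'' C theta) /\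
  (forall (p q : nat) (theta : pformula L p q),
     exemplifies_SOP2'' C theta ->
     exists k : nat, exemplifies_SOP2 C (conj_power theta k)).
Proof.
split=> p q theta; first exact: sop2_sop2''.
case=> n [d [W [cardW [a [a_branch [m a_emb]]]]]].
have [w w_succ] := successor_sequence cardW.
(* The threshold of the inconsistency clause itself serves as the number of teeth. *)
have [k hk] := conj_power_tree w_succ a_branch (a_emb m (leqnn m)).
exists k; apply: sop2_compactness hk; first exact: monster_saturated hC.
exact: monster_large hC.
Qed.
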